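(* Let $n \geq 1$, $m, d \geq 0$ be integers and let $\lambda = (m+d, d, \ldots, d)$ be the partition with $n$ parts. Then \[ A_\lambda(n) = \frac{A(n)}{\binom{3n-2}{n-1}}\sum_{j=1}^n \binom{m+j-1}{m}\binom{n+j-2}{n-1}\binom{2n-1-j}{n-1} = A(n)\sum_{k=0}^{m}\binom{m}{k}\frac{(n+k-1)!\,(2n-1)!}{k!\,(n-k-1)!\,(2n+k-1)!}, \] and moreover there exist polynomials $P_m$ of degree $2m - \lfloor \frac{m+1}{2}\rfloor$ and $Q_m$ of degree $m - \lfloor \frac{m+1}{2}\rfloor$ (depending only on $m$) such that $A_\lambda(n) = A(n)\cdot \frac{P_m(n)}{Q_m(n)}$.
   Context: Six-vertex model: on an $r \times c$ grid there are $r$ horizontal lines and $c$ vertical lines meeting in $rc$ vertices. Each horizontal line consists of $c+1$ edges (the outermost ones are a left and a right boundary edge) and each vertical line of $r+1$ edges (the outermost ones are a top and a bottom boundary edge). A state assigns an orientation to every edge, agreeing with prescribed orientations on the boundary edges, such that at every vertex exactly two of the four adjacent edges point into the vertex and two point out. For a partition $\lambda = (\lambda_1, \ldots, \lambda_n)$ (integers $\lambda_1 \geq \cdots \geq \lambda_n \geq 0$), $A_\lambda(n)$ is the number of states on the grid with $n$ rows and $n + \lambda_1$ columns with boundary conditions: left boundary arrows point right, right boundary arrows point left, bottom boundary arrows point down, and, numbering columns $1, \ldots, n+\lambda_1$ from right to left, the top boundary arrow in column $i$ points up if $i \in \{\lambda_k + n + 1 - k : 1 \leq k \leq n\}$ and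 down otherwise. Also $A(n) = \prod_{j=0}^{n-1}\frac{(3j+1)!}{(n+j)!}$ (the number of $n\times n$ alternating sign matrices). In the second sum, $1/N! := 0$ for negative integers $N$ (so terms with $k \geq n$ vanish). *)

(* Defs.v *)
From mathcomp Require Import all_boot all_order all_algebra.
Set Implicit Arguments. Unset Strict Implicit. Unset Printing Implicit Defensive.
Import Order.TTheory GRing.Theory Num.Theory.

(* Six-vertex states on an r x c grid.
   Rows are indexed 0..r-1 from top to bottom, columns 0..c-1 from left to
   right (positionally).  A state is a pair of boolean functions:
   - horizontal edges (i, k), i < r, k <= c : true iff the arrow points RIGHT;
     edge k of row i lies between (positional) columns k-1 and k, so k = 0 is
     the left boundary edge and k = c the right boundary edge;
   - vertical edges (j, k), j < c, k <= r : true iff the arrow points UP;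
     edge k of column j lies between rows k-1 and k, so k = 0 is the top
     boundary edge and k = r the bottom boundary edge. *)
Definition sv_state (r c : nat) : finType :=
  ({ffun 'I_r * 'I_c.+1 -> bool} * {ffun 'I_c * 'I_r.+1 -> bool})%type.

Definition hor (r c : nat) (s : sv_state r c) (i : 'I_r) (k : nat) : bool :=
  s.1 (i, inord k).
Definition ver (r c : nat) (s : sv_state r c) (j : 'I_c) (k : nat) : bool :=
  s.2 (j, inord k).

Definition in_count (r c : nat) (s : sv_state r c) (i : 'I_r) (j : 'I_c) : nat :=
  (hor s i j : nat)              (* left edge points right *)
  + (~~ hor s i j.+1 : nat)      (* right edge points left *)
  + (~~ ver s j i : nat)         (* top edge points down *)
  + (ver s j i.+1 : nat).        (* bottom edge points up *)

Definition sv_valid (r c : nat) (top : nat -> bool) (s : sv_state r c) : bool :=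
  [forall i : 'I_r, hor s i 0 && ~~ hor s i c]
  && [forall j : 'I_c, ~~ ver s j r && (ver s j 0 == top j)]
  && [forall i : 'I_r, forall j : 'I_c, in_count s i j == 2].

Definition sv_count (r c : nat) (top : nat -> bool) : nat :=
  #|[pred s : sv_state r c | sv_valid top s]|.

(* the set {lambda_k + n + 1 - k : 1 <= k <= n}; with 0-based k' = k-1 this is
   {lambda_(k') + n - k' : 0 <= k' < n}, lam given as a list (lambda_1,...,lambda_n) *)
Definition up_col (n : nat) (lam : seq nat) (i : nat) : bool :=
  has (fun k => i == nth 0 lam k + n - k) (iota 0 n).

(* A_lambda(n): grid with n rows and n + lambda_1 columns; columns are numbered
   1..n+lambda_1 from RIGHT to LEFT for the top boundary, so positional column
   j (0-based from the left) has number (n + lambda_1) - j. *)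
Definition A_lam (n : nat) (lam : seq nat) : nat :=
  let N := n + head 0 lam in
  sv_count n N (fun j => up_col n lam (N - j)).

Definition ASM (n : nat) : rat :=
  \prod_(j < n) (((3 * j).+1)`!%:R / (n + j)`!%:R).

Definition lam_md (n m d : nat) : seq nat := (m + d) :: nseq n.-1 d.

(* Main.v *)
(* A column with top arrow down, read from the left, moves the unique
   left-pointing arrow of its incoming edges weakly downwards.  The m such columns that
   follow the leftmost one therefore contribute 'C(m + j - 1, m) when that
   arrow ends in row j, and the statement reduces to the refined enumeration of
   alternating sign matrices: the number with their first-column 1 in row j is
   proportional to 'C(n + j - 2, n - 1) * 'C(2n - 1 - j, n - 1).

   For this, give row i a spectral parameter x_i, column j a parameter y_j, and
   weigh vertices at Delta = 1/2 (w a primitive cube root of unity).  Let Z(t)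
   be the partition function, t the parameter of the leftmost column, and
   F(t) = Z(t) prod_i (t - x_i) prod_(j > 1) (t - y_j).  By Yang-Baxter Z is
   symmetric in the x_i; at t = w x_i and t = w^2 x_i row i may be moved to the
   top resp. bottom, where it freezes, and both times the same smaller partition
   function appears.  Hence F(t) + w F(wt) + w^2 F(w^2 t) vanishes at the 3n
   points w^e x_i, while its degree is at most 3n - 2; so it is zero (this is
   Stroganov's functional equation).  At x_i = y_j = 1, where all weights are
   1, and in the variable z = b/a (the ratio of the weights of the leftmost column)
   it says that, with g(z) = sum_k g_k z^k the generating function of the refined
   counts, g(z) (1 - z)^(2n-1) has no monomial of degree n, ..., 2n - 2.  Up to a
   scalar exactly one g of degree < n has this gap, because a nonzero polynomial
   with k monomials cannot vanish to order k at 1; the product of binomials is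
   a solution because it turns the gap into a vanishing n-1st difference.  The scalar is
   found by induction: the count for row 1 at size n is the total at size n-1. *)
Require Import Defs.
From mathcomp Require Import all_boot all_order all_algebra.
From mathcomp Require Import algC ring zify.
Import Order.TTheory GRing.Theory Num.Theory.
Set Implicit Arguments. Unset Strict Implicit. Unset Printing Implicit Defensive.
Local Open Scope ring_scope.

Lemma big_bool2 (V : nmodType) (F : bool * bool -> V) :
  \sum_k F k = F (true, true) + F (true, false) + (F (false, true) + F (false, false)).
Proof.
have /= := pair_bigA +%R (fun i j => F (i, j)); rewrite !big_bool => /esym <-.
by apply: eq_bigr => -[].
Qed.

(** * Transfer operators and the Yang-Baxter equation *)

Section RowOperator.
Variables (R : comNzRingType) (mu : R).

(* [h], [h'] are the left and right edges ([true] = right), [e], [e'] the top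
   and bottom edges ([true] = up).  At a root of [3 mu (1 - mu) = 1] these are the weights
   a, b, c at Delta = 1/2 up to normalisation, and they all equal 1 at [x = y = 1]. *)
Definition vertex_weight (x y : R) (h e h' e' : bool) : R :=
  if (h == h') && (e == e') then
    (if h == e then mu * x + (1 - mu) * y else (1 - mu) * x + mu * y)
  else if (h == e) && (h' == e') then (if h then x else y) else 0.

(* Row-to-row transfer operator: the sum over the vertical edges [v] below a
   row of the weight of the row with [u] above it, times [f v]. *)
Fixpoint rowop (x : R) (h hb : bool) (ys : seq R) (f : seq bool -> R)
    (u : seq bool) : R :=
  match ys, u with
  | y :: ys', e :: u' =>
      \sum_(h' : bool) \sum_(e' : bool)
        vertex_weight x y h e h' e' * rowop x h' hb ys' (fun v => f (e' :: v)) u'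
  | _, _ => if h == hb then f [::] else 0
  end.

Lemma eq_rowop x h hb ys f g u : f =1 g -> rowop x h hb ys f u = rowop x h hb ys g u.
Proof.
elim: ys h f g u => [|y ys IH] h f g [|e u] fg //=; rewrite ?fg //.
apply: eq_bigr => h' _; apply: eq_bigr => e' _; congr (_ * _).
by apply: IH => v; rewrite fg.
Qed.

Lemma rowop_lin x h hb ys u f g (c : R) :
  rowop x h hb ys (fun v => c * f v + g v) u
  = c * rowop x h hb ys f u + rowop x h hb ys g u.
Proof.
elim: ys h f g u => [|y ys IH] h f g [|e u] //=;
  try by case: ifP; rewrite // mulr0 addr0.
rewrite !big_bool /= !IH; ring.
Qed.

Lemma rowop_scale x h hb ys u f (c : R) :
  rowop x h hb ys (fun v => c * f v) u = c * rowop x h hb ys f u.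
Proof.
elim: ys h f u => [|y ys IH] h f [|e u] //=;
  try by case: ifP; rewrite // mulr0.
rewrite !big_bool /= !IH; ring.
Qed.

Lemma rowop0 x h hb ys u : rowop x h hb ys (fun _ => 0) u = 0.
Proof.
rewrite -[RHS](mul0r (rowop x h hb ys (fun=> 0) u)) -rowop_scale.
by apply: eq_rowop => v; rewrite mul0r.
Qed.

Lemma rowopD x h hb ys u f g :
  rowop x h hb ys (fun v => f v + g v) u = rowop x h hb ys f u + rowop x h hb ys g u.
Proof.
by rewrite -[X in X + _]mul1r -rowop_lin; apply: eq_rowop => v; rewrite mul1r.
Qed.

Lemma rowop_sum x h hb ys u (I : Type) (r : seq I) (P : pred I) (F : I -> seq bool -> R) :
  rowop x h hb ys (fun v => \sum_(i <- r | P i) F i v) u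
  = \sum_(i <- r | P i) rowop x h hb ys (F i) u.
Proof.
elim: r => [|i r IH].
  by rewrite big_nil -[RHS](rowop0 x h hb ys u); apply: eq_rowop => v; rewrite big_nil.
rewrite big_cons -IH; case: ifP => Pi.
  by rewrite -rowopD; apply: eq_rowop => v; rewrite big_cons Pi.
by apply: eq_rowop => v; rewrite big_cons Pi.
Qed.

Hypothesis muP : 3 * mu * (1 - mu) = 1.

(** The R-matrix of the model: a crossing of two rows, to the left or right of a column, that
    exchanges their parameters. *)
Definition r_matrix (x1 x2 : R) (h1 h2 k1 k2 : bool) : R :=
  if (h1 == h2) && (k1 == k2) && (h1 == k1) then mu * x1 + (1 - mu) * x2
  else if (h1 != h2) && (k1 != k2) then
    (if h1 == k1 then (if h1 then x2 else x1)
     else (x1 - x2) * (mu - (1 - mu)))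
  else 0.

Lemma yang_baxter x1 x2 y h1 h2 e g1 g2 e' :
  \sum_(k1 : bool) \sum_(k2 : bool) r_matrix x1 x2 h1 h2 k1 k2 *
     \sum_(m : bool) vertex_weight x1 y k1 e g1 m * vertex_weight x2 y k2 m g2 e'
  = \sum_(k1 : bool) \sum_(k2 : bool)
     (\sum_(m : bool) vertex_weight x2 y h1 e k1 m * vertex_weight x1 y h2 m k2 e')
      * r_matrix x1 x2 k1 k2 g1 g2.
Proof.
have quadratic_vanishes (E c : R) : E = c * (1 - 3 * mu * (1 - mu)) -> E = 0.
  by rewrite muP subrr mulr0.
rewrite !big_bool /=.
case: h1; case: h2; case: e; case: g1; case: g2; case: e';
  rewrite /vertex_weight /r_matrix /=; try ring; apply/eqP; rewrite -subr_eq0; apply/eqP;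
  (* both sides have degree 2 in [mu], so the cofactor is the value at 0 *)
  match goal with |- ?E = 0 =>
    match eval pattern mu in E with ?g _ =>
      apply: (quadratic_vanishes _ (g 0)); ring end end.
Qed.

Lemma two_rows_cons x1 x2 y ys h1 h2 g1 g2 f e u :
  rowop x1 h1 g1 (y :: ys) (rowop x2 h2 g2 (y :: ys) f) (e :: u)
  = \sum_(e' : bool) \sum_(k : bool * bool)
      (\sum_(m : bool) vertex_weight x1 y h1 e k.1 m * vertex_weight x2 y h2 m k.2 e')
      * rowop x1 k.1 g1 ys (rowop x2 k.2 g2 ys (fun v => f (e' :: v))) u.
Proof.
under [RHS]eq_bigr => e' _ do rewrite big_bool2.
rewrite /= !big_bool /= !rowop_sum !big_bool /= !rowop_sum !big_bool /= !rowop_scale.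
ring.
Qed.

Lemma rowop_nilr x h hb ys f : rowop x h hb ys f [::] = (h == hb)%:R * f [::].
Proof. by case: ys => [|y ys] /=; case: ifP; rewrite ?mul1r ?mul0r. Qed.

Lemma rowop_nill x h hb f u : rowop x h hb [::] f u = (h == hb)%:R * f [::].
Proof. by rewrite /=; case: ifP; rewrite ?mul1r ?mul0r. Qed.

(** The train argument: [yang_baxter] moves the R-matrix across one column, and induction on the
    columns carries it from the left end of the two rows to the right end. *)
Lemma rowop_intertwine x1 x2 ys h g f u :
  \sum_(k : bool * bool) r_matrix x1 x2 h.1 h.2 k.1 k.2 *
     rowop x1 k.1 g.1 ys (rowop x2 k.2 g.2 ys f) u
  = \sum_(k : bool * bool)
     rowop x2 h.1 k.1 ys (rowop x1 h.2 k.2 ys f) u * r_matrix x1 x2 k.1 k.2 g.1 g.2.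
Proof.
elim: ys h g f u => [|y ys IH] [h1 h2] g f [|e u].
1-3: case: g => g1 g2; rewrite !big_bool2 !(rowop_nill, rowop_nilr) /=.
1-3: by case: h1; case: h2; case: g1; case: g2 => /=; ring.
under eq_bigr => k _ do rewrite two_rows_cons mulr_sumr.
under [RHS]eq_bigr => k _ do rewrite two_rows_cons mulr_suml.
rewrite exchange_big [RHS]exchange_big /=; apply: eq_bigr => e' _.
under eq_bigr => k _ do rewrite mulr_sumr.
under [RHS]eq_bigr => k _ do rewrite mulr_suml.
rewrite exchange_big [RHS]exchange_big /=.
transitivity (\sum_(j : bool * bool) (\sum_(k : bool * bool)
    (\sum_(m : bool) vertex_weight x2 y h1 e k.1 m * vertex_weight x1 y h2 m k.2 e')
    * r_matrix x1 x2 k.1 k.2 j.1 j.2)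
   * rowop x1 j.1 g.1 ys (rowop x2 j.2 g.2 ys (fun v => f (e' :: v))) u).
  apply: eq_bigr => j _; under eq_bigr => k _ do rewrite mulrA.
  rewrite -mulr_suml; congr (_ * _).
  have := yang_baxter x1 x2 y h1 h2 e j.1 j.2 e'; rewrite !big_bool2 !big_bool /=; exact.
under [LHS]eq_bigr => j _ do rewrite mulr_suml.
rewrite exchange_big /=; apply: eq_bigr => k _.
under [LHS]eq_bigr => j _ do rewrite -mulrA.
rewrite -mulr_sumr IH mulr_sumr.
by apply: eq_bigr => j _; rewrite mulrA.
Qed.

(** With equal boundary arrows on the two rows the R-matrix acts at both ends as the scalar
    [mu * x1 + (1 - mu) * x2], which can then be cancelled. *)
Lemma rowop_comm x1 x2 ys f u : GRing.lreg (mu * x1 + (1 - mu) * x2) ->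
  rowop x1 true false ys (rowop x2 true false ys f) u
  = rowop x2 true false ys (rowop x1 true false ys f) u.
Proof.
move=> reg; apply: reg.
have := rowop_intertwine x1 x2 ys (true, true) (false, false) f u.
by rewrite !big_bool2 /r_matrix /= !mul0r !mulr0 !addr0 !add0r => ->; rewrite mulrC.
Qed.
End RowOperator.

(** * Partition functions, frozen rows and frozen columns *)

Section Ice.
Variables (R : comNzRingType) (mu : R).
Local Notation rowop := (rowop mu).
Local Notation wa x y := ((1 - mu) * x + mu * y).
Local Notation wb x y := (mu * x + (1 - mu) * y).

Lemma rowop_TF x hb y ys f u :
  rowop x true hb (y :: ys) f (false :: u)
  = wa x y * rowop x true hb ys (fun v => f (false :: v)) u.
Proof. by rewrite /= !big_bool /vertex_weight /= !mul0r !addr0 !add0r. Qed.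

Lemma rowop_TT x hb y ys f u :
  rowop x true hb (y :: ys) f (true :: u)
  = wb x y * rowop x true hb ys (fun v => f (true :: v)) u
    + x * rowop x false hb ys (fun v => f (false :: v)) u.
Proof. by rewrite /= !big_bool /vertex_weight /= !mul0r !addr0 !add0r. Qed.

Lemma rowop_FT x hb y ys f u :
  rowop x false hb (y :: ys) f (true :: u)
  = wa x y * rowop x false hb ys (fun v => f (true :: v)) u.
Proof. by rewrite /= !big_bool /vertex_weight /= !mul0r !addr0 !add0r. Qed.

Lemma rowop_FF x hb y ys f u :
  rowop x false hb (y :: ys) f (false :: u)
  = wb x y * rowop x false hb ys (fun v => f (false :: v)) u
    + y * rowop x true hb ys (fun v => f (true :: v)) u.
Proof. by rewrite /= !big_bool /vertex_weight /= !mul0r !addr0 !add0r addrC. Qed.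

Lemma eq_rowop_size x h hb ys f g u : size u = size ys ->
  (forall v, size v = size ys -> f v = g v) ->
  rowop x h hb ys f u = rowop x h hb ys g u.
Proof.
elim: ys h f g u => [|y ys IH] h f g [|e u] //= => [_ -> //|[su] fg].
apply: eq_bigr => h' _; apply: eq_bigr => e' _; congr (_ * _).
by apply: IH => // v sv; rewrite fg //= sv.
Qed.

Definition down (u : seq bool) : R := (all negb u)%:R.

(* Each entry [(x, h)] is a row with parameter [x] and leftmost edge [h]. *)
Definition ice_from (f : seq bool -> R) (xh : seq (R * bool)) ys :=
  foldr (fun p => rowop p.1 p.2 false ys) f xh.
Definition ice := ice_from down.

Definition all_right (xs : seq R) : seq (R * bool) := [seq (x, true) | x <- xs].

Lemma eq_ice_from f g xh ys u : f =1 g -> ice_from f xh ys u = ice_from g xh ys u.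
Proof. by move=> fg; elim: xh u => [|p xh IH] u //=; apply: eq_rowop. Qed.

(** A down arrow on top and right arrows on the left freeze the column: the arrow runs straight
    down, and all rows go on pointing right. *)
Lemma ice_F xs y ys u :
  ice (all_right xs) (y :: ys) (false :: u)
  = (\prod_(x <- xs) wa x y) * ice (all_right xs) ys u.
Proof.
elim: xs u => [|x xs IH] u; first by rewrite big_nil mul1r.
rewrite /ice /ice_from /= -/(rowop _) big_cons -mulrA -rowop_scale.
have /= -> := rowop_TF x false y ys _ u.
by congr (_ * _); apply: eq_rowop => v; apply: IH.
Qed.

Lemma rowop_T_frozen x ys f :
  rowop x false false ys f (nseq (size ys) true)
  = (\prod_(y <- ys) wa x y) * f (nseq (size ys) true).
Proof.
elim: ys f => [|y ys IH] f; first by rewrite big_nil mul1r.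
by rewrite [nseq _ _]/= rowop_FT IH big_cons mulrA.
Qed.

Lemma rowop_down x ys u : size u = size ys ->
  rowop x false false ys down u = (\prod_(y <- ys) wb x y) * down u.
Proof.
elim: ys u => [|y ys IH] [|[] u] // => [_|[su]|[su]].
- by rewrite big_nil mul1r.
- by rewrite rowop_FT rowop0 [down (true :: u)]/down /= !mulr0.
- rewrite rowop_FF rowop0 mulr0 addr0 big_cons -mulrA.
  by rewrite [down (false :: u)]/down /= -IH.
Qed.

(* With [wb x y = 0] the first row must turn at its first vertex, which fixes
   the whole first row and first column. *)
Lemma ice_frozen_first x xs y ys : wb x y = 0 ->
  ice (all_right (x :: xs)) (y :: ys) (nseq (size ys).+1 true)
  = x * (\prod_(y' <- ys) wa x y') * (\prod_(x' <- xs) wa x' y)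
    * ice (all_right xs) ys (nseq (size ys) true).
Proof.
move=> b0; rewrite [LHS](rowop_TT x false y ys) b0 mul0r add0r -!mulrA.
rewrite rowop_T_frozen; congr (_ * (_ * _)); exact: ice_F.
Qed.

(** The counterpart of [ice_frozen_first] at the bottom: [wa x y = 0] excludes a down arrow entering
    the last row in the first column, so the up arrow passes straight through all rows above and
    turns in the last one. There the bottom boundary fixes everything else. *)
Lemma ice_frozen_last x xs y ys u : size u = size ys -> wa x y = 0 ->
  ice (all_right (rcons xs x)) (y :: ys) (true :: u)
  = x * (\prod_(y' <- ys) wb x y') * (\prod_(x' <- xs) wb x' y) * ice (all_right xs) ys u.
Proof.
move=> su a0; rewrite /all_right map_rcons /ice /ice_from foldr_rcons -/(all_right xs).
set L := rowop (x, true).1 _ _ _ _.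
have LF v : L (false :: v) = 0 by rewrite /L rowop_TF a0 mul0r.
have LT v : size v = size ys -> L (true :: v) = (x * \prod_(y' <- ys) wb x y') * down v.
  by move=> sv; rewrite /L rowop_TT rowop0 mulr0 add0r -mulrA -rowop_down.
have LFs s v : foldr (fun p => rowop p.1 p.2 false (y :: ys)) L (all_right s) (false :: v) = 0.
  elim: s v => [|x' s IH] v //=.
  have /= -> := rowop_TF x' false y ys _ v.
  by rewrite (eq_rowop _ _ _ _ _ _ IH) rowop0 mulr0.
elim: xs u su => [|x' xs IH] u su /=; first by rewrite LT // big_nil mulr1.
have /= -> := rowop_TT x' false y ys _ u.
rewrite (eq_rowop _ _ _ _ _ _ (LFs xs)) rowop0 mulr0 addr0.
rewrite (eq_rowop_size _ _ _ su IH) rowop_scale big_cons.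
by rewrite mulrA; congr (_ * _); ring.
Qed.


Lemma ice_from_cat f s1 s2 ys : ice_from f (s1 ++ s2) ys = ice_from (ice_from f s2 ys) s1 ys.
Proof. exact: foldr_cat. Qed.

Hypothesis muP : 3 * mu * (1 - mu) = 1.

Lemma ice_from_comm f x xs ys u :
  (forall x', x' \in xs -> GRing.lreg (mu * x + (1 - mu) * x')) ->
  ice_from (rowop x true false ys f) (all_right xs) ys u
  = rowop x true false ys (ice_from f (all_right xs) ys) u.
Proof.
elim: xs u => [|x' xs IH] u reg //=.
rewrite rowop_comm //; last by apply: reg; rewrite mem_head.
by apply: eq_rowop => v; apply: IH => x'' x''in; apply: reg; rewrite inE x''in orbT.
Qed.

Lemma ice_move_first x s1 s2 ys u :
  (forall x', x' \in s1 -> GRing.lreg (mu * x + (1 - mu) * x')) ->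
  ice (all_right (s1 ++ x :: s2)) ys u = ice (all_right (x :: s1 ++ s2)) ys u.
Proof.
move=> reg; rewrite /ice /all_right /= !map_cat /= !ice_from_cat /=.
rewrite ice_from_comm //; exact: eq_rowop.
Qed.

Lemma ice_move_last x s1 s2 ys u :
  (forall x', x' \in s2 -> GRing.lreg (mu * x + (1 - mu) * x')) ->
  ice (all_right (s1 ++ x :: s2)) ys u = ice (all_right (rcons (s1 ++ s2) x)) ys u.
Proof.
move=> reg; rewrite /ice /all_right -cats1 !map_cat /= !ice_from_cat /=.
by apply: eq_ice_from => v; rewrite ice_from_comm.
Qed.

(* The rows [xs] with left boundary arrows pointing right except in row [k]:
   what remains of [all_right xs] to the right of a column whose top arrow is up. *)
Fixpoint one_left (k : nat) (xs : seq R) : seq (R * bool) :=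
  match xs, k with
  | [::], _ => [::]
  | x :: xs', 0 => (x, false) :: all_right xs'
  | x :: xs', k'.+1 => (x, true) :: one_left k' xs'
  end.

(** The weight of a first column with top arrow up that turns in row [k]: straight vertices [wb]
    above the turn, frozen vertices [wa] below it. *)
Fixpoint column_weight (k : nat) (xs : seq R) (y : R) : R :=
  match xs, k with
  | [::], _ => 0
  | x :: xs', 0 => x * \prod_(x' <- xs') wa x' y
  | x :: xs', k'.+1 => wb x y * column_weight k' xs' y
  end.

Lemma ice_T xs y ys u :
  ice (all_right xs) (y :: ys) (true :: u)
  = \sum_(k < size xs) column_weight k xs y * ice (one_left k xs) ys u.
Proof.
elim: xs u => [|x xs IH] u; first by rewrite big_ord0 /ice /= /down.
have /= -> := rowop_TT x false y ys _ u.
rewrite (eq_rowop _ _ _ _ _ _ IH) rowop_sum big_ord_recl addrC /=; congr (_ + _).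
  rewrite -mulrA; congr (_ * _); rewrite -rowop_scale.
  by apply: eq_rowop => v; apply: ice_F.
rewrite mulr_sumr; apply: eq_bigr => k _.
by rewrite rowop_scale mulrA.
Qed.

(** [column_weight] as a polynomial in the column parameter, for the degree bound in the functional
    equation. *)
Fixpoint column_weight_poly (k : nat) (xs : seq R) : {poly R} :=
  match xs, k with
  | [::], _ => 0
  | x :: xs', 0 => x%:P * \prod_(x' <- xs') (((1 - mu) * x')%:P + mu%:P * 'X)
  | x :: xs', k'.+1 => ((mu * x)%:P + (1 - mu)%:P * 'X) * column_weight_poly k' xs'
  end.

Lemma column_weight_polyE k xs y : (column_weight_poly k xs).[y] = column_weight k xs y.
Proof.
elim: xs k => [|x xs IH] [|k] /=; rewrite ?horner0 //.
  by rewrite hornerM hornerC horner_prod; congr (_ * _);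
    apply: eq_bigr => x' _; rewrite hornerD hornerM !hornerC hornerX.
by rewrite hornerM hornerD hornerM !hornerC hornerX -IH.
Qed.

Lemma size_linear_mul (a b : R) (p : {poly R}) n : (size p <= n)%N ->
  (size ((a%:P + b%:P * 'X) * p)%R <= n.+1)%N.
Proof.
move=> sp; have sl : (size (a%:P + b%:P * 'X)%R <= 2)%N.
  rewrite (leq_trans (size_polyD _ _)) // geq_max (leq_trans (size_polyC_leq1 _)) //=.
  by rewrite mul_polyC (leq_trans (size_scale_leq _ _)) // size_polyX.
rewrite (leq_trans (size_polyMleq _ _)) //.
by move: (size _) (size p) sl sp => m k; lia.
Qed.

Lemma size_column_weight_poly k xs : (size (column_weight_poly k xs) <= size xs)%N.
Proof.
elim: xs k => [|x xs IH] [|k] /=; rewrite ?size_poly0 ?size_linear_mul //.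
rewrite mul_polyC (leq_trans (size_scale_leq _ _)) //.
elim: xs {IH} => [|x' xs IH]; first by rewrite big_nil size_poly1.
by rewrite big_cons size_linear_mul.
Qed.

Lemma prod_wa1 n : \prod_(x <- nseq n 1) wa x 1 = 1.
Proof. by rewrite big_nseq; elim: n => //= n ->; ring. Qed.

Lemma column_weight1 k n : (k < n)%N -> column_weight k (nseq n 1) 1 = 1.
Proof.
elim: n k => // n IH [|k] /= kn; first by rewrite prod_wa1 mulr1.
by rewrite IH //; ring.
Qed.

Lemma ice_T1 n ys u :
  ice (all_right (nseq n 1)) (1 :: ys) (true :: u)
  = \sum_(0 <= j < n) ice (one_left j (nseq n 1)) ys u.
Proof.
rewrite ice_T size_nseq big_mkord; apply: eq_bigr => j _.
by rewrite column_weight1 ?mul1r.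
Qed.

(** The left arrow of row [k] either passes straight through the column or turns the column arrow
    up. In the latter case the column arrow turns back in some lower row [j], which then carries the
    left arrow. All weights are 1 here. *)
Lemma ice_one_left_F k n ys u : (k < n)%N ->
  ice (one_left k (nseq n 1)) (1 :: ys) (false :: u)
  = \sum_(k <= j < n) ice (one_left j (nseq n 1)) ys u.
Proof.
have e1 : mu * 1 + (1 - mu) * 1 = 1 by ring.
have e2 : (1 - mu) * 1 + mu * 1 = 1 by ring.
elim: n k u => // n IH [|k] u kn.
  have /= -> := rowop_FF 1 false 1 ys _ u.
  rewrite big_nat_recl // e1 !mul1r; congr (_ + _).
    apply: eq_rowop => v; rewrite -[LHS]/(ice (all_right _) (1 :: ys) (false :: v)) ice_F.
    by rewrite prod_wa1 mul1r.
  rewrite -rowop_sum; apply: eq_rowop => v; exact: ice_T1.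
have /= -> := rowop_TF 1 false 1 ys _ u.
rewrite e2 mul1r big_add1 /= -rowop_sum; apply: eq_rowop => v.
exact: IH.
Qed.
End Ice.

Lemma prod_scale (R : comNzRingType) (I : Type) (s : seq I) (c : R) (f g : I -> R) :
  (forall x, f x = c * g x) -> \prod_(x <- s) f x = c ^+ size s * \prod_(x <- s) g x.
Proof.
move=> fg; elim: s => [|x s IH]; first by rewrite !big_nil mulr1.
by rewrite !big_cons IH fg exprS; ring.
Qed.

Lemma uniq_map_inj (T1 T2 : eqType) (f : T1 -> T2) (s : seq T1) :
  uniq (map f s) -> {in s &, injective f}.
Proof.
elim: s => // z s IH /= /andP[zs U] x y; rewrite !inE.
move=> /predU1P[->|xs] /predU1P[->|ys] // e; last exact: IH.
- by rewrite e map_f in zs.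
- by rewrite -e map_f in zs.
Qed.

(** * Stroganov's functional equation *)

Section FunctionalEquation.
Variables (R : idomainType) (mu : R).
Hypothesis muP : 3 * mu * (1 - mu) = 1.
Local Notation wa x y := ((1 - mu) * x + mu * y).
Local Notation wb x y := (mu * x + (1 - mu) * y).

(** Equality modulo the relation for [mu]; in each application [c] is the quotient of [L - M] by
    [1 - 3 * mu * (1 - mu)]. *)
Lemma mu_reduce (c L M : R) : L - M = c * (1 - 3 * mu * (1 - mu)) -> L = M.
Proof. by rewrite muP subrr mulr0 => /eqP; rewrite subr_eq0 => /eqP. Qed.

(* The cube root of unity in terms of which the two weights are proportional
   to [x - omega y] and [x - omega^2 y]. *)
Definition omega : R := - 3 * mu ^+ 2.
Local Notation w := omega.

Lemma omega_sum : 1 + w + w ^+ 2 = 0.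
Proof.
apply: (mu_reduce (c := 1 + 3 * mu + 3 * mu ^+ 2)).
rewrite /omega; ring.
Qed.

Lemma omega3 : w ^+ 3 = 1.
Proof.
have : w ^+ 3 - 1 = (w - 1) * (1 + w + w ^+ 2) by ring.
by rewrite omega_sum mulr0 => /eqP; rewrite subr_eq0 => /eqP.
Qed.

Lemma omega_mu : 1 - mu = - w ^+ 2 * mu.
Proof.
apply: (mu_reduce (c := 1 + 2 * mu + 3 * mu ^+ 2 + 3 * mu ^+ 3)).
rewrite /omega; ring.
Qed.


Lemma omega_neq1 : w != 1.
Proof.
apply/eqP => w1; have := omega_sum; rewrite w1 expr1n => three0.
have e3 : 3 = 1 + 1 + 1 :> R by ring.
by move: muP => /eqP; rewrite e3 three0 !mul0r eq_sym oner_eq0.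
Qed.

Lemma mu_neq0 : mu != 0.
Proof. by apply: contraTneq isT => m0; move/eqP: muP; rewrite m0 mulr0 mul0r eq_sym oner_eq0. Qed.

(** The added factors vanish at [t = x] and complete the products of frozen weights at [t = w * x]
    and [t = w ^+ 2 * x], so that these agree up to powers of [- w] and [- w ^+ 2]. *)
Definition ice_numerator xs ys t : R :=
  ice mu (all_right xs) (t :: ys) (nseq (size ys).+1 true)
  * \prod_(x <- xs) (t - x) * \prod_(y <- ys) (t - y).

(** The scalar is [mu * (x - w ^+ 2 * x')], so it can only vanish when the cubes coincide. The
    condition on cubes is symmetric and covers every power of [w] at once. *)
Lemma cubes_lreg x x' : x ^+ 3 != x' ^+ 3 -> GRing.lreg (mu * x + (1 - mu) * x').
Proof.
move=> ne; apply: mulfI; apply: contra_neq ne => d0.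
have : mu * (x - w ^+ 2 * x') = 0 by rewrite -d0 omega_mu; ring.
move/eqP; rewrite mulf_eq0 (negPf mu_neq0) subr_eq0 => /eqP ->.
by rewrite exprMn -exprM -[(2 * 3)%N]/(3 * 2)%N exprM omega3 expr1n mul1r.
Qed.

Lemma numerator_cancel xs ys x :
  x \in xs -> uniq [seq x ^+ 3 | x <- xs] -> size xs = (size ys).+1 ->
  w * ice_numerator xs ys (w * x) + w ^+ 2 * ice_numerator xs ys (w ^+ 2 * x) = 0.
Proof.
move=> xin; case/splitPr: xin => s1 s2 U sz.
have {sz} sz : size (s1 ++ s2) = size ys.
  by move: sz; rewrite !size_cat /= addnS => -[].
have reg x' : x' \in s1 ++ s2 -> GRing.lreg (mu * x + (1 - mu) * x').
  move=> x'in; apply: cubes_lreg.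
  move: U; rewrite map_cat /= -cat1s uniq_catCA cat1s /= -map_cat => /andP[+ _].
  by apply: contraNneq => ->; apply: map_f.
rewrite /ice_numerator.
have b0 : wb x (w * x) = 0 by rewrite omega_mu; ring: omega3.
have a0 : wa x (w ^+ 2 * x) = 0 by rewrite omega_mu; ring.
have -> f : \prod_(x <- s1 ++ x :: s2) f x = f x * \prod_(x <- s1 ++ s2) f x :> R.
  by rewrite !big_cat big_cons /= mulrCA.
have -> f : \prod_(x <- s1 ++ x :: s2) f x = f x * \prod_(x <- s1 ++ s2) f x :> R.
  by rewrite !big_cat big_cons /= mulrCA.
rewrite ice_move_first //; last by move=> x' x'in; apply: reg; rewrite mem_cat x'in.
rewrite ice_frozen_first //.
rewrite ice_move_last //; last by move=> x' x'in; apply: reg; rewrite mem_cat x'in orbT.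
rewrite ice_frozen_last ?size_nseq //.
(* Up to constants [wa x' (w * x)] is [w ^+ 2 * x - x'] and [wb x' (w ^+ 2 * x)] is [w * x - x'], so
   both sides contain the same two linear factors for each [x']. *)
have ex : \prod_(x' <- s1 ++ s2) wa x' (w * x) * \prod_(x' <- s1 ++ s2) (w * x - x')
   = (- w ^+ 2) ^+ size ys * (\prod_(x' <- s1 ++ s2) wb x' (w ^+ 2 * x)
     * \prod_(x' <- s1 ++ s2) (w ^+ 2 * x - x')).
  rewrite -sz -!big_split /=; apply: prod_scale => x'.
  rewrite omega_mu; ring: omega3.
have ey : \prod_(y <- ys) wa x y * \prod_(y <- ys) (w * x - y)
   = (- w) ^+ size ys * (\prod_(y <- ys) wb x y * \prod_(y <- ys) (w ^+ 2 * x - y)).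
  rewrite -!big_split /=; apply: prod_scale => y.
  rewrite omega_mu; ring: omega3.
set Z := ice _ _ _ _; set A1 := \prod_(y <- ys) wa x y in ey *.
set A2 := \prod_(x' <- _) wa x' _ in ex *; set A3 := \prod_(x' <- _) (w * x - x') in ex *.
set A4 := \prod_(y <- ys) (w * x - y) in ey *.
set B1 := \prod_(y <- ys) wb x y in ey *.
set B2 := \prod_(x' <- _) wb x' _ in ex *.
set B3 := \prod_(x' <- _) (w ^+ 2 * x - x') in ex *.
set B4 := \prod_(y <- ys) (w ^+ 2 * x - y) in ey *.
(* The constants cancel because as many rows as columns remain after freezing. *)
have e1 : (- w ^+ 2) ^+ size ys * (- w) ^+ size ys = 1.
  by rewrite -exprMn mulrNN -exprSr omega3 expr1n.
transitivity (w * x * (w * x - x) * Z * (A2 * A3) * (A1 * A4)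
  + w ^+ 2 * x * (w ^+ 2 * x - x) * Z * (B2 * B3) * (B1 * B4)); first by ring.
rewrite ex ey.
transitivity (x ^+ 2 * Z * B1 * B2 * B3 * B4
   * (w * (w - 1) * ((- w ^+ 2) ^+ size ys * (- w) ^+ size ys)
      + w ^+ 2 * (w ^+ 2 - 1))); first by ring.
rewrite e1; ring: omega3.
Qed.

Lemma functional_equation xs ys t :
  uniq [seq x ^+ 3 | x <- xs] -> 0 \notin xs -> size xs = (size ys).+1 ->
  ice_numerator xs ys t + w * ice_numerator xs ys (w * t)
  + w ^+ 2 * ice_numerator xs ys (w ^+ 2 * t) = 0.
Proof.
move=> U x0 sz; set n := size ys in sz.
pose u := nseq n true.
pose P : {poly R} := (\sum_(k < size xs) ice mu (one_left k xs) ys u *: column_weight_poly mu k xs)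
  * \prod_(x <- xs) ('X - x%:P) * \prod_(y <- ys) ('X - y%:P).
have PE z : P.[z] = ice_numerator xs ys z.
  rewrite /P /ice_numerator !hornerM !horner_prod; congr (_ * _ * _).
  - rewrite ice_T horner_sum; apply: eq_bigr => k _.
    by rewrite hornerZ column_weight_polyE mulrC.
  - by apply: eq_bigr => x _; rewrite hornerXsubC.
  - by apply: eq_bigr => x _; rewrite hornerXsubC.
have sS : (size (\sum_(k < size xs) ice mu (one_left k xs) ys u
    *: column_weight_poly mu k xs)%R <= n.+1)%N.
  rewrite -sz (leq_trans (size_sum _ _ _)) //; apply/bigmax_leqP => k _.
  by rewrite (leq_trans (size_scale_leq _ _)) // size_column_weight_poly.
have sP : (size P <= 3 * n + 2)%N.
  rewrite {PE}/P; move: (\sum_(k < _) _) sS => S sS.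
  rewrite (leq_trans (size_polyMleq _ _)) // size_prod_XsubC addnS /=.
  rewrite (leq_trans (leq_add (size_polyMleq _ _) (leqnn _))) // size_prod_XsubC sz.
  by move: (size S) sS; rewrite -/n => m; lia.
pose W := P + w *: (P \Po (w *: 'X)) + w ^+ 2 *: (P \Po (w ^+ 2 *: 'X)).
have WE z : W.[z] = ice_numerator xs ys z + w * ice_numerator xs ys (w * z)
  + w ^+ 2 * ice_numerator xs ys (w ^+ 2 * z).
  by rewrite /W !hornerD !hornerZ !horner_comp !hornerZ hornerX !PE.
have sW : (size W <= 3 * n + 2)%N.
  have sc c : (size (P \Po (c *: 'X))%R <= 3 * n + 2)%N.
    rewrite (leq_trans (size_comp_poly_leq _ _)) //.
    have sX : (size (c *: 'X)%R <= 2)%N.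
      by rewrite (leq_trans (size_scale_leq _ _)) // size_polyX.
    have : ((size (c *: 'X)%R).-1 <= 1)%N by case: (size _) sX => [|[]].
    move/(leq_mul (leqnn (size P).-1)) => /leq_ltn_trans; apply.
    by move: (size P) sP => a; lia.
  rewrite (leq_trans (size_polyD _ _)) // geq_max (leq_trans (size_polyD _ _)) ?geq_max.
    by rewrite (leq_trans (size_scale_leq _ _)).
  by rewrite sP (leq_trans (size_scale_leq _ _)).
rewrite -WE; suff -> : W = 0 by rewrite horner0.
apply: contraTeq isT => Wn0.
(* Replacing [z] by [w * z] permutes the three terms cyclically, so the roots of [W] are closed
   under multiplication by [w]. *)
have Ww z : W.[w * z] = w ^+ 2 * W.[z].
  rewrite !WE (_ : w * (w * z) = w ^+ 2 * z); last by ring.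
  rewrite (_ : w ^+ 2 * (w * z) = z); last by ring: omega3.
  ring: omega3.
have Wx x : x \in xs -> root W x.
  move=> xin; rewrite /root WE -addrA numerator_cancel // addr0 /ice_numerator.
  by rewrite (big_rem x xin) /= subrr !(mul0r, mulr0).
(* The orbits of the row parameters give [3 * n + 3] distinct roots, against a degree of at most
   [3 * n + 1]. *)
pose rs := [seq c * x | c <- [:: 1; w; w ^+ 2], x <- xs].
have : (size rs < size W)%N.
  apply: max_poly_roots => //.
    apply/allP => _ /allpairsP[[c x] /= [cin xin ->]].
    have r0 := Wx x xin; have r1 : root W (w * x) by rewrite /root Ww (eqP r0) mulr0.
    have r2 : root W (w ^+ 2 * x) by rewrite expr2 -mulrA /root Ww (eqP r1) mulr0.
    by move: cin; rewrite !inE => /or3P[] /eqP ->; rewrite ?mul1r.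
  apply: allpairs_uniq.
  - rewrite /= !inE !negb_or.
    have w0 : w != 0.
      by apply: contra_eq_neq omega3 => ->; rewrite expr0n eq_sym oner_eq0.
    rewrite andbT eq_sym omega_neq1 /= -{2}[w]mulr1 expr2 (inj_eq (mulfI w0)).
    rewrite [1 == w]eq_sym omega_neq1 andbT.
    rewrite -expr2; apply: contraNneq omega_neq1 => w2.
    by rewrite -omega3 exprS -w2 mulr1.
  - exact: map_uniq U.
  move=> [c x] [c1 x1] /allpairsP[[c0 x0'] [cin xin [-> ->]]].
  move=> /allpairsP[[c' x'] [cin' xin' [-> ->]]].
  rewrite /= in cin xin cin' xin' *; move: c0 x0' cin xin => {}c {}x cin xin e.
  have c3 d : d \in [:: 1; w; w ^+ 2] -> d ^+ 3 = 1.
    rewrite !inE => /or3P[] /eqP ->; rewrite ?expr1n ?omega3 //.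
    by rewrite -exprM mulnC exprM omega3 expr1n.
  have ex : x = x'.
    apply: (uniq_map_inj U xin xin').
    by have /= := congr1 (fun z => z ^+ 3) e; rewrite !exprMn (c3 c cin) (c3 c' cin') !mul1r.
  rewrite -ex in e *; congr pair; apply: (mulIf _ e).
  by apply: contraNneq x0 => <-.
rewrite size_allpairs /= sz => /leq_trans/(_ sW); rewrite ltnNge => /negP[]; lia.
Qed.

End FunctionalEquation.

(** * Specialisation to equal parameters *)

Section Morphism.
Variables (R S : comNzRingType) (phi : {rmorphism R -> S}) (mu : R).

Lemma vertex_weight_morph x y h e h' e' :
  phi (vertex_weight mu x y h e h' e') = vertex_weight (phi mu) (phi x) (phi y) h e h' e'.
Proof.
by rewrite /vertex_weight; do ![case: ifP => _];
  rewrite ?rmorph0 ?rmorphD ?rmorphM ?rmorphB ?rmorph1.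
Qed.

Lemma rowop_morph x h hb ys f u :
  phi (rowop mu x h hb ys f u) = rowop (phi mu) (phi x) h hb (map phi ys) (phi \o f) u.
Proof.
elim: ys h f u => [|y ys IH] h f [|e u] /=; try by case: ifP => _; rewrite ?rmorph0.
rewrite rmorph_sum; apply: eq_bigr => h' _; rewrite rmorph_sum; apply: eq_bigr => e' _.
by rewrite rmorphM vertex_weight_morph IH.
Qed.

Lemma ice_morph xs ys u :
  phi (ice mu (all_right xs) ys u) = ice (phi mu) (all_right (map phi xs)) (map phi ys) u.
Proof.
elim: xs u => [|x xs IH] u; first by rewrite /ice /= /down rmorph_nat.
by rewrite [LHS]rowop_morph; apply: eq_rowop.
Qed.
End Morphism.

Lemma ice_numerator_morph (R S : idomainType) (phi : {rmorphism R -> S}) mu xs ys t :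
  phi (ice_numerator mu xs ys t)
  = ice_numerator (phi mu) (map phi xs) (map phi ys) (phi t).
Proof.
rewrite /ice_numerator !rmorphM ice_morph !rmorph_prod !big_map size_map.
by congr (_ * _ * _); apply: eq_bigr => z _; rewrite rmorphB.
Qed.

Section Homogeneous.
Variables (C : numFieldType) (mu : C).
Hypothesis muP : 3 * mu * (1 - mu) = 1.
Local Notation w := (omega mu).

(* The functional equation needs the cubes of the row parameters distinct, so
   it is applied to the parameters [1 + i X] over {poly C}, then [X := 0]. *)
Lemma homogeneous_equation n t :
  let F t := ice mu (all_right (nseq n.+1 1)) (t :: nseq n 1) (nseq n.+1 true)
             * (t - 1) ^+ (2 * n).+1 in
  F t + w * F (w * t) + w ^+ 2 * F (w ^+ 2 * t) = 0.
Proof.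
move=> F.
pose xs : seq {poly C} := [seq 1 + i%:R *: 'X | i <- iota 0 n.+1].
have muP' : 3 * mu%:P * (1 - mu%:P) = 1.
  by rewrite -[RHS](congr1 polyC muP) !rmorphM rmorphB rmorph1 rmorph_nat.
have U : uniq [seq x ^+ 3 | x <- xs].
  rewrite -map_comp map_inj_uniq ?iota_uniq // => i j /= /(congr1 (horner^~ 1)).
  rewrite !hornerE /= !nat1r => /(pexpIrn (isT : 0 < 3)%N) e.
  by apply: succn_inj; apply/eqP; rewrite -(eqr_nat C) e // ?nnegrE ler0n.
have n0 : 0 \notin xs.
  apply/mapP => -[i _ /(congr1 (horner^~ 0)) /eqP].
  by rewrite !hornerE eq_sym oner_eq0.
have wE : omega mu%:P = w%:P by rewrite /omega rmorphM rmorphN rmorphXn rmorph_nat.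
pose phi : {rmorphism {poly C} -> C} := horner_eval 0.
have hC c : phi c%:P = c by rewrite /= /horner_eval hornerC.
have NE s : phi (ice_numerator mu%:P xs (nseq n 1) s%:P) = F s.
  have xs1 : map phi xs = nseq n.+1 (1 : C).
    rewrite -map_comp; elim: n.+1 0%N => //= m IH i.
    by rewrite IH /horner_eval !hornerE.
  rewrite ice_numerator_morph xs1 map_nseq /ice_numerator size_nseq !hC ?rmorph1.
  rewrite -mulrA; congr (_ * _).
  by rewrite !big_nseq -!Monoid.iteropE -exprD; congr (_ ^+ _); lia.
have /(congr1 phi) : ice_numerator mu%:P xs (nseq n 1) t%:P
    + w%:P * ice_numerator mu%:P xs (nseq n 1) (w * t)%:P
    + (w ^+ 2)%:P * ice_numerator mu%:P xs (nseq n 1) (w ^+ 2 * t)%:P = 0.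
  rewrite ![(_ * t)%:P]polyCM !polyC_exp -wE.
  by apply: functional_equation; rewrite // size_map size_iota size_nseq.
by rewrite !rmorphD [phi (w%:P * _)]rmorphM [phi ((w ^+ 2)%:P * _)]rmorphM !NE !hC => ->.
Qed.

End Homogeneous.

(** * Polynomials with a gap *)

Section SparsePolynomials.
Variable F : numFieldType.

Definition theta (c : F) (p : {poly F}) : {poly F} := 'X * p^`() - c *: p.

Lemma coef_theta c p i : (theta c p)`_i = (i%:R - c) * p`_i.
Proof.
rewrite /theta coefB coefZ coefXM mulrBl; congr (_ - _).
by case: i => [|i]; rewrite ?mul0r // coef_deriv mulr_natl.
Qed.

(* [theta c] lowers the order of vanishing at 1 by at most one, and kills the
   monomial of degree [c]. *)
Lemma theta_root1 c p q m : p = (1 - 'X) ^+ m.+1 * q ->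
  exists q', theta c p = (1 - 'X) ^+ m * q'.
Proof.
move=> ->; exists ('X * ((1 - 'X) * q^`() - q *+ m.+1) - c *: ((1 - 'X) * q)).
rewrite /theta derivM deriv_exp derivB derivX derivC -!mul_polyC /= exprS.
rewrite -[_ *+ m.+1]mulr_natl -[q *+ _]mulr_natl; ring.
Qed.

Lemma foldr_theta_coef cs p i :
  (foldr theta p cs)`_i = \prod_(c <- cs) (i%:R - c) * p`_i.
Proof.
by elim: cs => [|c cs IH]; rewrite ?big_nil ?mul1r //= coef_theta IH big_cons mulrA.
Qed.

Lemma foldr_theta_root1 cs p q m : p = (1 - 'X) ^+ (size cs + m) * q ->
  exists q', foldr theta p cs = (1 - 'X) ^+ m * q'.
Proof.
elim: cs m => [|c cs IH] m /= pE; first by exists q.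
have [|q' /(theta_root1 c)] := IH m.+1; first by rewrite addnS.
by [].
Qed.

(** Applying [theta e] removes one admissible monomial at the cost of one order of vanishing, so by
    induction [theta e%:R p = 0]. Then [p] is a multiple of ['X^e], which does not vanish at 1. *)
Lemma sparse_eq0 (E : seq nat) (p q : {poly F}) :
  (forall i, i \notin E -> p`_i = 0) -> p = (1 - 'X) ^+ (size E) * q -> p = 0.
Proof.
elim: E p q => [|e E IH] p q supp pE.
  by apply/polyP => i; rewrite coef0 supp.
have [q' thE] := theta_root1 e%:R pE.
have th0 : theta e%:R p = 0.
  apply: IH thE => i iE; rewrite coef_theta.
  have [->|ie] := eqVneq i e; first by rewrite subrr mul0r.
  by rewrite supp ?mulr0 // inE negb_or ie.
have {}supp i : i != e -> p`_i = 0.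
  move=> ie; have /eqP := congr1 (fun s : {poly F} => s`_i) th0.
  by rewrite /= coef_theta coef0 mulf_eq0 subr_eq0 eqr_nat (negPf ie) => /eqP.
have pX : p = p`_e *: 'X^e.
  apply/polyP => i; rewrite coefZ coefXn; have [->|ie] := eqVneq i e.
    by rewrite mulr1.
  by rewrite mulr0 supp.
have : p.[1] = 0 by rewrite pE hornerM horner_exp !hornerE subrr expr0n /= mul0r.
by rewrite {1}pX hornerZ hornerXn expr1n mulr1 => pe0; rewrite pX pe0 scale0r.
Qed.
End SparsePolynomials.

(** * The gap condition: uniqueness and explicit solution *)

Section Pade.
Variable F : numFieldType.

(** For [p] of degree at most [n] this is the Padé condition of type [n/n] on [p] as a denominator
    for [(1 - 'X) ^+ (2 * n).+1]. *)
Definition pade_gap n (p : {poly F}) :=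
  forall i, (n < i <= 2 * n)%N -> (p * (1 - 'X) ^+ (2 * n).+1)`_i = 0.

Lemma pade_gap_eq0 n (p : {poly F}) : (size p <= n.+1)%N ->
  pade_gap n p -> p`_0 = 0 -> p = 0.
Proof.
move=> sp gap p0; set M := (2 * n).+1 in gap.
have sX : size ((1 - 'X) ^+ M : {poly F}) = M.+1.
  rewrite (_ : 1 - 'X = - ('X - 1%:P)); last by rewrite opprB.
  by rewrite exprNn -signr_odd mulr_sign; case: odd; rewrite ?size_polyN size_exp_XsubC.
have s0 : p * (1 - 'X) ^+ M = 0.
  (* The product has degree at most [3 * n + 1] and no constant term, so only [n + n.+1] monomials
     lie outside the gap. This is exactly the order of vanishing at 1. *)
  apply: (@sparse_eq0 _ (iota 1 n ++ iota M n.+1) _ p).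
    move=> i; rewrite mem_cat !mem_iota => iE.
    have [i0|i0] := eqVneq i 0%N.
      by rewrite i0 coefM big_ord_recl big_ord0 /= p0 mul0r addr0.
    have [iM|iM] := leqP i (2 * n); first by apply: gap; lia.
    apply: nth_default; rewrite (leq_trans (size_polyMleq _ _)) // sX.
    by move: (size p) sp => s; lia.
  by rewrite size_cat !size_iota mulrC; congr (_ ^+ _ * _); rewrite /M; lia.
move/eqP: s0; rewrite mulf_eq0 => /orP[/eqP //|].
by rewrite -size_poly_eq0 sX.
Qed.

Lemma pade_gap_unique n (p q : {poly F}) : (size p <= n.+1)%N -> (size q <= n.+1)%N ->
  pade_gap n p -> pade_gap n q -> q`_0 *: p = p`_0 *: q.
Proof.
move=> sp sq gp gq; apply/eqP; rewrite -subr_eq0; apply/eqP.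
apply: (@pade_gap_eq0 n).
- rewrite (leq_trans (size_polyD _ _)) // size_polyN geq_max.
  by rewrite !(leq_trans (size_scale_leq _ _)).
- move=> i ni; rewrite mulrBl -!scalerAl coefB !coefZ gp // gq //.
  by rewrite !mulr0 subrr.
by rewrite coefB !coefZ mulrC subrr.
Qed.

Definition pade_sol n : {poly F} :=
  \poly_(k < n.+1) ('C(n + k, n) * 'C(2 * n - k, n))%:R.

Lemma coef_exp_1subX m i : (((1 - 'X) ^+ m : {poly F})`_i = (-1) ^+ i * 'C(m, i)%:R)%R.
Proof.
rewrite exprBn coef_sum; have [im|mi] := ltnP i m.+1; last first.
  rewrite bin_small // mulr0 big1 // => j _.
  rewrite coefMn expr1n mulr1 -polyC1 -polyCN -polyC_exp coefCM coefXn.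
  by rewrite (gtn_eqF (leq_ltn_trans (leq_ord j) mi)) mulr0 mul0rn.
rewrite (bigD1 (Ordinal im)) //= big1 => [|j ji].
  rewrite addr0 coefMn expr1n mulr1 -polyC1 -polyCN -polyC_exp coefCM coefXn.
  by rewrite eqxx mulr1 mulr_natr.
rewrite coefMn expr1n mulr1 -polyC1 -polyCN -polyC_exp coefCM coefXn.
by rewrite -val_eqE eq_sym /= in ji; rewrite (negPf ji) mulr0 mul0rn.
Qed.

(** Each term of the convolution becomes a constant times ['C(n, k)] times two falling factorials,
    which form a polynomial in [k] of degree [n - 1]. *)
Lemma pade_sol_term n k i : (k <= n)%N -> (n < i <= 2 * n)%N ->
  ('C(n + k, n) * 'C(2 * n - k, n) * 'C((2 * n).+1, i - k) * (n`! * n`! * n`!)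
   = (2 * n).+1`! * 'C(n, k) * ((n + k) ^_ (i - n.+1) * (2 * n - k) ^_ (2 * n - i)))%N.
Proof.
move=> kn /andP[ni i2n].
have e1 : ('C(n + k, n) * (n`! * k`!) = (n + k)`!)%N.
  by rewrite -[in RHS](bin_fact (leq_addr k n)) addKn.
have e2 : ('C(2 * n - k, n) * (n`! * (n - k)`!) = (2 * n - k)`!)%N.
  have le : (n <= 2 * n - k)%N by lia.
  by rewrite -(bin_fact le); congr (_ * (_ * _`!))%N; lia.
have e3 : ('C((2 * n).+1, i - k) * ((i - k)`! * ((2 * n).+1 + k - i)`!) = (2 * n).+1`!)%N.
  have le : (i - k <= (2 * n).+1)%N by lia.
  by rewrite -(bin_fact le); congr (_ * (_ * _`!))%N; lia.
have e4 := bin_fact kn.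
have e5 : ((n + k) ^_ (i - n.+1) * ((2 * n).+1 + k - i)`! = (n + k)`!)%N.
  have le : (i - n.+1 <= n + k)%N by lia.
  by rewrite -(ffact_fact le); congr (_ * _ `!)%N; lia.
have e6 : ((2 * n - k) ^_ (2 * n - i) * (i - k)`! = (2 * n - k)`!)%N.
  have le : (2 * n - i <= 2 * n - k)%N by lia.
  by rewrite -(ffact_fact le); congr (_ * _ `!)%N; lia.
have D0 : (0 < k`! * (n - k)`! * ((i - k)`! * ((2 * n).+1 + k - i)`!))%N.
  by rewrite !muln_gt0 !fact_gt0.
apply/eqP; rewrite -(eqn_pmul2r D0); apply/eqP.
transitivity ((n + k)`! * (2 * n - k)`! * (2 * n).+1`! * n`!)%N.
  by rewrite -{1}e1 -{1}e2 -{1}e3; ring.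
by rewrite -{1}e5 -{1}e6 -{1}e4; ring.
Qed.

(** The [n]-th difference of a polynomial of degree below [n] vanishes: the sum is the value at 1 of
    [(1 - 'X) ^+ n] after fewer than [n] operators [theta]. *)
Lemma alternating_sum_prod n (cs : seq F) : (size cs < n)%N ->
  \sum_(k < n.+1) (-1) ^+ k * 'C(n, k)%:R * \prod_(c <- cs) (k%:R - c) = 0.
Proof.
move=> scs; pose p : {poly F} := foldr (@theta F) ((1 - 'X) ^+ n) cs.
have [q pE] : exists q, p = (1 - 'X) ^+ (n - size cs) * q.
  by apply: (@foldr_theta_root1 _ _ _ 1); rewrite mulr1 subnKC // ltnW.
have sp : (size p <= n.+1)%N.
  apply/leq_sizeP => j nj; rewrite foldr_theta_coef coef_exp_1subX.
  by rewrite bin_small // !mulr0.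
transitivity p.[1]; last first.
  rewrite pE hornerM horner_exp !hornerE subrr.
  by rewrite expr0n subn_eq0 leqNgt scs mul0r.
rewrite (horner_coef_wide 1 sp).
apply: eq_bigr => k _; rewrite expr1n mulr1 foldr_theta_coef coef_exp_1subX.
by rewrite mulrC.
Qed.

Lemma pade_sol_gap n : pade_gap n (pade_sol n).
Proof.
move=> i ni; rewrite coefM.
have in1 : (n.+1 <= i.+1)%N by lia.
rewrite -(big_mkord xpredT (fun j => (pade_sol n)`_j * ((1 - 'X) ^+ (2 * n).+1)`_(i - j))).
rewrite (big_cat_nat _ in1) //= [X in _ + X]big_nat_cond [X in _ + X]big1 ?addr0; last first.
  by move=> j /andP[/andP[nj _] _]; rewrite coef_poly ltnNge nj mul0r.
rewrite big_mkord.
(* The roots in [k] of the two falling factorials, [n - 1] in all. The sign [(-1) ^+ (2 * n - i)] in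
   [K] comes from the factors of the second one, where [k] occurs negatively. *)
pose cs : seq F := [seq l%:R - n%:R | l <- iota 0 (i - n.+1)]
  ++ [seq (2 * n)%:R - l%:R | l <- iota 0 (2 * n - i)].
have scs : (size cs < n)%N by rewrite size_cat !size_map !size_iota; lia.
pose K : F := (-1) ^+ i * (-1) ^+ (2 * n - i) * ((2 * n).+1`!)%:R / (n`! * n`! * n`!)%:R.
transitivity (K * \sum_(k < n.+1) (-1) ^+ k * 'C(n, k)%:R * \prod_(c <- cs) (k%:R - c));
  last by rewrite alternating_sum_prod ?mulr0.
rewrite mulr_sumr.
apply: eq_bigr => -[k kn] _ /=; rewrite ltnS in kn.
rewrite coef_poly ltnS kn coef_exp_1subX.
have f0 : (n`! * n`! * n`!)%:R != 0 :> F by rewrite pnatr_eq0 -lt0n !muln_gt0 !fact_gt0.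
apply: (mulIf f0); rewrite [RHS](_ : _ = (-1) ^+ i * (-1) ^+ (2 * n - i)
   * ((2 * n).+1`!)%:R * ((-1) ^+ k * 'C(n, k)%:R * \prod_(c <- cs) (k%:R - c)));
  last by rewrite mulrAC divfK.
have -> : \prod_(c <- cs) (k%:R - c)
    = ((n + k) ^_ (i - n.+1))%:R * ((-1) ^+ (2 * n - i) * ((2 * n - k) ^_ (2 * n - i))%:R).
  rewrite big_cat !big_map /=; congr (_ * _).
    rewrite ffact_prod natr_prod -(big_mkord xpredT (fun l => (n + k - l)%:R)) /index_iota subn0.
    rewrite big_seq [RHS]big_seq; apply: eq_bigr => l; rewrite mem_iota => /andP[_ li].
    by rewrite natrB ?natrD; [ring | lia].
  rewrite ffact_prod natr_prod -(big_mkord xpredT (fun l => (2 * n - k - l)%:R)) /index_iota subn0.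
  rewrite (@prod_scale _ _ _ (-1) _ (fun l => (2 * n)%:R - k%:R - l%:R)) ?size_iota => [|l].
    congr (_ * _); rewrite big_seq [RHS]big_seq; apply: eq_bigr => l.
    rewrite mem_iota => /andP[_ li].
    by rewrite !natrB //; lia.
  by ring.
have sg : (-1) ^+ (i - k) = (-1) ^+ i * (-1) ^+ k :> F.
  have ki : (k <= i)%N by lia.
  by rewrite -{2}(subnK ki) exprD -mulrA -expr2 sqrr_sign mulr1.
have sg2 : (-1) ^+ (2 * n - i) * (-1) ^+ (2 * n - i) = 1 :> F by rewrite -expr2 sqrr_sign.
have := congr1 (fun m => m%:R : F) (pade_sol_term kn ni).
move: (n`!) ((2 * n).+1`!) => f B; rewrite !natrM sg => e.
transitivity ((-1) ^+ i * (-1) ^+ k * (B%:R * 'C(n, k)%:R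
  * (((n + k) ^_ (i - n.+1))%:R * ((2 * n - k) ^_ (2 * n - i))%:R)) : F).
  by rewrite -e; ring.
by rewrite -[LHS]mulr1 -[X in _ * X = _]sg2; ring.
Qed.
End Pade.

(** * The refined enumeration *)

Section RefinedCountEquation.
Variables (C : numFieldType) (mu : C).
Hypothesis muP : 3 * mu * (1 - mu) = 1.
Local Notation w := (omega mu).

(* The number of alternating sign matrices of size [n.+1] whose first column
   has its 1 in row [k]: the first column is stripped off, and among its right
   edges only the one in row [k] points left. *)
Definition refined_count n k : C := ice mu (one_left k (nseq n.+1 1)) (nseq n 1) (nseq n true).

Definition refined_form n (a b : C) : C :=
  \sum_(k < n.+1) refined_count n k * (b ^+ k * a ^+ (n - k)).

Lemma refined_formM n c a b : refined_form n (c * a) (c * b) = c ^+ n * refined_form n a b.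
Proof.
rewrite /refined_form mulr_sumr; apply: eq_bigr => -[k kn] _ /=.
rewrite ltnS in kn; rewrite !exprMn -[in X in _ = X * _](subnKC kn) exprD; ring.
Qed.

Lemma ice_refined_form n t :
  ice mu (all_right (nseq n.+1 1)) (t :: nseq n 1) (nseq n.+1 true)
  = refined_form n ((1 - mu) * 1 + mu * t) (mu * 1 + (1 - mu) * t).
Proof.
have wcolE m k : (k <= m)%N -> column_weight mu k (nseq m.+1 1) t
    = (mu * 1 + (1 - mu) * t) ^+ k * ((1 - mu) * 1 + mu * t) ^+ (m - k).
  elim: k m => [|k IH] [|m] // km; last by rewrite [LHS]/= IH // exprS -mulrA.
    by rewrite /= big_nil mulr1.
  rewrite -[LHS]/(1 * \prod_(x' <- nseq m.+1 1) ((1 - mu) * x' + mu * t)).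
  by rewrite big_nseq -Monoid.iteropE.
rewrite ice_T size_nseq; apply: eq_bigr => -[k kn] _.
by rewrite /= wcolE // mulrC.
Qed.

(** Needed to divide in [three_term]. Otherwise [mu] would be the inverse of [i.+1], and its
    equation would give [3 * i = i.+1 ^ 2], which no natural number satisfies. *)
Lemma natr_denom_neq0 i : mu * i%:R - (1 - mu) != 0.
Proof.
apply/eqP => d0.
have e : mu * i.+1%:R = 1.
  by rewrite -natr1; move/eqP: d0; rewrite subr_eq0 => /eqP e; rewrite mulrDr e mulr1 subrK.
have : (3 * i)%:R = (i.+1 * i.+1)%:R :> C.
  have {}d0 : mu * i%:R = 1 - mu by apply/eqP; rewrite -subr_eq0 d0.
  rewrite !natrM.
  transitivity (3 * mu * (mu * i%:R) * (i.+1%:R * i.+1%:R)).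
    by transitivity (3 * i%:R * (mu * i.+1%:R) * (mu * i.+1%:R)); [rewrite e !mulr1|ring].
  by rewrite d0 muP mul1r.
by move/eqP; rewrite eqr_nat; nia.
Qed.

Lemma mu_neq_half : mu - (1 - mu) != 0.
Proof.
have e : 3 * (mu - (1 - mu)) ^+ 2 = -1.
  by apply: (mu_reduce muP (c := 4)); ring.
apply/eqP => d0; move/eqP: e.
by rewrite d0 expr0n mulr0 eq_sym oppr_eq0 oner_eq0.
Qed.

(** Cancels the common factor [v ^+ n * v ^+ 2 * s ^+ n * q ^+ (2 * n).+1], up to sign, using only
    [v ^+ 3 = 1]. *)
Lemma three_term_unscale n (v s q z g1 g2 g3 : C) :
  v ^+ 2 = - 1 - v -> s != 0 -> q != 0 ->
  s ^+ n * g1 * (- v ^+ 2 * q * (1 - z)) ^+ (2 * n).+1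
  + v * ((- v ^+ 2 * s) ^+ n * g2 * (v * q) ^+ (2 * n).+1)
  + v ^+ 2 * ((v * s) ^+ n * g3 * (- 1 * q * z) ^+ (2 * n).+1) = 0 ->
  g1 * (1 - z) ^+ (2 * n).+1 + (-1) ^+ n.+1 * g2 + z ^+ (2 * n).+1 * g3 = 0.
Proof.
move=> v2 s0 q0; have v3 : v ^+ 3 = 1 by ring: v2.
have v0 : v != 0 by apply: contra_eq_neq v3 => ->; rewrite expr0n eq_sym oner_eq0.
have V3 : (v ^+ n) ^+ 3 = 1 by rewrite exprAC v3 expr1n.
have oddM (x : C) : x ^+ (2 * n).+1 = (x ^+ n) ^+ 2 * x by rewrite exprSr mulnC exprM.
have sg : (-1) ^+ n * (-1) ^+ n = 1 :> C by rewrite -expr2 sqrr_sign.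
have vn : (- v ^+ 2) ^+ n = (-1) ^+ n * (v ^+ n) ^+ 2.
  by rewrite [LHS]exprNn [in RHS]exprAC.
move=> e; have u0 : - (v ^+ n * v ^+ 2 * s ^+ n * q ^+ (2 * n).+1) != 0.
  by rewrite oppr_eq0; do ![apply: mulf_neq0]; rewrite ?expf_neq0.
apply: (mulfI u0); rewrite mulr0 -e !oddM [(-1) ^+ n.+1]exprS !exprMn vn.
move: (v ^+ n) V3 ((-1) ^+ n) sg => V V3 S sg.
have {}sg : S ^+ 2 = 1 by rewrite expr2.
ring: V3 sg.
Qed.

(* The functional equation at the parameter [t] with [b(t) / a(t) = i]; the
   substitution [t -> omega t] acts on [(a, b)] as [(b, b - a)] up to a scalar. *)
Lemma three_term n i : let z : C := i%:R in
  refined_form n 1 z * (1 - z) ^+ (2 * n).+1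
  + (-1) ^+ n.+1 * refined_form n z (z - 1)
  + z ^+ (2 * n).+1 * refined_form n (z - 1) (- 1) = 0.
Proof.
move=> z; have d0 := natr_denom_neq0 i; rewrite -/z in d0.
(* [t] solves [b(t) = z * a(t)], and [s] is the resulting value of [a(t)]. *)
pose s := (mu - (1 - mu)) / (mu * z - (1 - mu)).
pose t := (mu - (1 - mu) * z) / (mu * z - (1 - mu)).
have s0 : s != 0 by rewrite mulf_neq0 ?invr_neq0 ?mu_neq_half.
have a1 : (1 - mu) * 1 + mu * t = s * 1 by rewrite /s /t; field.
have b1 : mu * 1 + (1 - mu) * t = s * z by rewrite /s /t; field.
have m0 := mu_neq0 muP; have w2 : w ^+ 2 = - 1 - w by rewrite -[RHS]addr0 -(omega_sum muP); ring.
have ow := omega_mu muP.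
have a2 : (1 - mu) * 1 + mu * (w * t) = - w ^+ 2 * s * z.
  by rewrite -[in RHS]mulrA -b1 ow; ring: w2.
have b2 : mu * 1 + (1 - mu) * (w * t) = - w ^+ 2 * s * (z - 1).
  transitivity (- w ^+ 2 * (s * z - s * 1)); last by ring.
  by rewrite -b1 -a1 ow; ring: w2.
have ab : s * (1 - z) = (mu - (1 - mu)) * (t - 1).
  transitivity (s * 1 - s * z); first by ring.
  by rewrite -b1 -a1; ring.
have a3 : (1 - mu) * 1 + mu * (w ^+ 2 * t) = w * s * (z - 1).
  transitivity (w * (s * z - s * 1)); last by ring.
  by rewrite -b1 -a1 ow; ring: w2.
have b3 : mu * 1 + (1 - mu) * (w ^+ 2 * t) = w * s * (- 1).
  transitivity (- w * (s * 1)); last by ring.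
  by rewrite -a1 ow; ring: w2.
have t1 : t - 1 = - w ^+ 2 * (s / mu) * (1 - z).
  apply: (mulfI m0); transitivity (- w ^+ 2 * (s * (1 - z))); last by field.
  by rewrite ab ow; ring: w2.
have t2 : w * t - 1 = w * (s / mu).
  apply: (mulfI m0); transitivity (w * (s * 1)); last by field.
  by rewrite -a1 ow; ring: w2.
have t3 : w ^+ 2 * t - 1 = - 1 * (s / mu) * z.
  apply: (mulfI m0); transitivity (- (s * z)); last by field.
  by rewrite -b1 ow; ring: w2.
have := homogeneous_equation muP n t.
cbv beta zeta; rewrite !ice_refined_form a1 b1 a2 b2 a3 b3 t1 t2 t3.
rewrite !refined_formM; apply: three_term_unscale => //.
by rewrite mulf_neq0 ?invr_neq0.
Qed.

Lemma poly_natr_roots (p : {poly C}) : (forall i : nat, p.[i%:R] = 0) -> p = 0.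
Proof.
move=> p0; apply: contraTeq isT => pn0.
have /(max_poly_roots pn0) : all (root p) [seq i%:R | i <- iota 0 (size p)].
  by apply/allP => _ /mapP[i _ ->]; apply/eqP.
rewrite map_inj_uniq ?iota_uniq; last by move=> i j /eqP; rewrite eqr_nat => /eqP.
by move=> /(_ isT); rewrite size_map size_iota ltnn.
Qed.

Definition refined_poly n : {poly C} := \poly_(k < n.+1) refined_count n k.

(** [three_term] holds at every natural number, hence as a polynomial identity. Its second summand
    has degree at most [n] and its third is divisible by ['X^((2 * n).+1)], so the first has no
    monomials in between. *)
Lemma refined_poly_gap n : pade_gap n (refined_poly n).
Proof.
pose S2 : {poly C} := \sum_(k < n.+1) refined_count n k *: (('X - 1) ^+ k * 'X ^+ (n - k)).
pose S3 : {poly C} := \sum_(k < n.+1) refined_count n k *: ((- 1) ^+ k * ('X - 1) ^+ (n - k)).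
pose H := refined_poly n * (1 - 'X) ^+ (2 * n).+1 + (-1) ^+ n.+1 *: S2
  + 'X^((2 * n).+1) * S3.
have H0 : H = 0.
  apply: poly_natr_roots => i; rewrite -[RHS](three_term n i).
  rewrite !hornerD !hornerM !horner_exp hornerZ !hornerE; congr (_ * _ + _ * _ + _ * _).
  - rewrite horner_poly; apply: eq_bigr => k _.
    by rewrite expr1n mulr1.
  - rewrite horner_sum; apply: eq_bigr => k _.
    by rewrite hornerZ hornerM !horner_exp !hornerE.
  - rewrite horner_sum; apply: eq_bigr => k _.
    by rewrite hornerZ hornerM !horner_exp !hornerE.
have sS2 : (size S2 <= n.+1)%N.
  rewrite (leq_trans (size_sum _ _ _)) //; apply/bigmax_leqP => -[k kn] _ /=.
  rewrite (leq_trans (size_scale_leq _ _)) // (leq_trans (size_polyMleq _ _)) //.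
  by rewrite -polyC1 size_exp_XsubC size_polyXn; lia.
move=> i /andP[ni i2n]; have := congr1 (fun p : {poly C} => p`_i) H0.
rewrite /= !coefD coefZ coefXnM ltnS i2n addr0 coef0 [S2`_i]nth_default ?mulr0 ?addr0 //.
exact: leq_trans sS2 ni.
Qed.

Lemma refined_ratio n k : (k <= n)%N ->
  refined_count n k * 'C(2 * n, n)%:R = refined_count n 0 * ('C(n + k, n) * 'C(2 * n - k, n))%:R.
Proof.
move=> kn; have := pade_gap_unique (size_poly _ _) (size_poly _ _)
  (@refined_poly_gap n) (@pade_sol_gap _ n).
move/(congr1 (fun p : {poly C} => p`_k)); rewrite /= !coefZ !coef_poly !ltnS kn leq0n /=.
by rewrite addn0 binn mul1n subn0 mulrC.
Qed.

Definition asm_total n : C := \sum_(k < n.+1) refined_count n k.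

Lemma refined_count00 : refined_count 0 0 = 1.
Proof. by rewrite /refined_count /ice /= /down. Qed.

(** A left arrow entering the first row under up arrows freezes that row; below it remains the
    square grid with [n.+1] rows. *)
Lemma refined_countS0 n : refined_count n.+1 0 = asm_total n.
Proof.
rewrite -[LHS]/(rowop mu 1 false false (nseq n.+1 1)
  (ice mu (all_right (nseq n.+1 1)) (nseq n.+1 1)) (nseq n.+1 true)).
have := rowop_T_frozen mu 1 (nseq n.+1 1); rewrite size_nseq => ->.
rewrite (ice_T1 mu n.+1 (nseq n 1) (nseq n true)) big_mkord.
rewrite big_nseq (_ : iter _ _ _ = 1) ?mul1r //.
by elim: n.+1 => //= m ->; ring.
Qed.
End RefinedCountEquation.

(** * Counting states by transfer operators *)

Lemma sum_tuple_cons (V : nmodType) (T : finType) c (G : seq T -> V) :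
  \sum_(t : c.+1.-tuple T) G t = \sum_(b : T) \sum_(t : c.-tuple T) G (b :: t).
Proof.
rewrite (pair_bigA _ (fun b (t : c.-tuple T) => G (b :: t))) /=.
rewrite (reindex (fun p : T * c.-tuple T => [tuple of p.1 :: p.2])) //=.
exists (fun t => (thead t, [tuple of behead t])) => [[b t]|t] _ /=.
  by congr pair; apply: val_inj.
by rewrite [RHS]tuple_eta.
Qed.

Lemma sum_tuple0 (V : nmodType) (T : finType) (G : seq T -> V) :
  \sum_(t : 0.-tuple T) G t = G [::].
Proof.
rewrite (bigD1 [tuple]) //= big1 ?addr0 // => t /eqP[].
exact: tuple0.
Qed.

(** The equation [h0 + e' == e + h] is the ice rule [in_count == 2] with the negations moved to the
    other side. *)
Fixpoint ice_row (h0 : bool) (u v hs : seq bool) : bool :=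
  match u, v, hs with
  | e :: u', e' :: v', h :: hs' => ((h0 + e' == e + h)%N) && ice_row h u' v' hs'
  | _, _, _ => ~~ h0
  end.

Lemma ice_rowP h0 c u v hs : size u = c -> size v = c -> size hs = c ->
  ice_row h0 u v hs = ~~ nth false (h0 :: hs) c &&
   all (fun j => nth false (h0 :: hs) j + nth false v j
               == nth false u j + nth false (h0 :: hs) j.+1)%N (iota 0 c).
Proof.
elim: c h0 u v hs => [|c IH] h0 [|e u] [|e' v] [|h hs] //=; first by rewrite andbT.
move=> [su] [sv] [sh]; rewrite IH // andbCA; congr (_ && _); congr (_ && _).
by rewrite -[iota 1 c]/(iota (1 + 0)%N c) iotaDl all_map; apply: eq_all => j.
Qed.

Section RowCount.
Variables (R : comNzRingType) (mu : R).

Lemma rowop_count h0 c f u : size u = c ->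
  rowop mu 1 h0 false (nseq c 1) f u
  = \sum_(v : c.-tuple bool) \sum_(hs : c.-tuple bool) (ice_row h0 u v hs)%:R * f v.
Proof.
elim: c h0 f u => [|c IH] h0 f [|e u] //= => [_|[su]].
  rewrite (sum_tuple0 (fun v : seq bool => \sum_(hs : 0.-tuple bool) (~~ h0)%:R * f v)).
  rewrite (sum_tuple0 (fun=> (~~ h0)%:R * f [::])).
  by case: h0; rewrite ?mul0r ?mul1r.
rewrite (sum_tuple_cons _ (fun v : seq bool =>
  \sum_(hs : c.+1.-tuple bool) (ice_row h0 (e :: u) v hs)%:R * f v)).
rewrite exchange_big; apply: eq_bigr => e' _ /=.
under [RHS]eq_bigr => v _ do rewrite (sum_tuple_cons _ (fun hs : seq bool =>
  (ice_row h0 (e :: u) (e' :: v) hs)%:R * f (e' :: v))) /=.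
rewrite exchange_big; apply: eq_bigr => h _ /=.
rewrite IH // mulr_sumr; apply: eq_bigr => v _.
rewrite mulr_sumr; apply: eq_bigr => hs _; rewrite mulrA; congr (_ * _).
rewrite -mulnb natrM; congr (_ * _).
rewrite /vertex_weight; case: h0; case: e; case: h; case: e' => //=; ring.
Qed.

End RowCount.

Section States.

Definition first_row r c (s : sv_state r c) : c.-tuple bool := [tuple ver s j 0 | j < c].

(** [v] lies above the new row; the edges below it are the top edges of [s]. This makes the
    decomposition a bijection without compatibility conditions. *)
Definition add_row r c (h : c.+1.-tuple bool) (v : c.-tuple bool) (s : sv_state r c) :
    sv_state r.+1 c :=
  ([ffun p => if unlift ord0 p.1 is Some i then s.1 (i, p.2) else tnth h p.2],
   [ffun p => if unlift ord0 p.2 is Some k then s.2 (p.1, k) else tnth v p.1]).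

Lemma add_row_bij r c : bijective (fun p : c.+1.-tuple bool * c.-tuple bool * sv_state r c =>
  add_row p.1.1 p.1.2 p.2).
Proof.
exists (fun s : sv_state r.+1 c => ([tuple s.1 (ord0, k) | k < c.+1],
  [tuple s.2 (j, ord0) | j < c],
  ([ffun p => s.1 (lift ord0 p.1, p.2)], [ffun p => s.2 (p.1, lift ord0 p.2)]))).
- move=> [[h v] [s1 s2]] /=; congr (_, _, (_, _)).
  + by apply: eq_from_tnth => k; rewrite tnth_mktuple ffunE /= unlift_none.
  + by apply: eq_from_tnth => k; rewrite tnth_mktuple ffunE /= unlift_none.
  + by apply/ffunP => -[i k]; rewrite !ffunE /= liftK.
  + by apply/ffunP => -[i k]; rewrite !ffunE /= liftK.
move=> [s1 s2]; congr (_, _); apply/ffunP => -[i k]; rewrite !ffunE /=.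
- by case: unliftP => [j|] ->; rewrite ?ffunE ?tnth_mktuple.
- by case: unliftP => [j|] ->; rewrite ?ffunE ?tnth_mktuple.
Qed.

Lemma forall_ord_recl n (P : pred 'I_n.+1) :
  [forall i, P i] = P ord0 && [forall i, P (lift ord0 i)].
Proof.
apply/forallP/andP => [H|[H0 /forallP HS] i]; first by split=> //; apply/forallP.
by case: (unliftP ord0 i) => [j|] ->.
Qed.

Lemma forall_and (T : finType) (P Q : pred T) :
  [forall i, P i && Q i] = [forall i, P i] && [forall i, Q i].
Proof.
apply/forallP/andP => [H|[/forallP HP /forallP HQ] i]; last by rewrite HP HQ.
by split; apply/forallP => i; have /andP[] := H i.
Qed.

Section AddRow.
Variables (r c : nat) (h : c.+1.-tuple bool) (v : c.-tuple bool) (s : sv_state r c).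

Lemma hor_add_row0 k : hor (add_row h v s) ord0 k = tnth h (inord k).
Proof. by rewrite /hor ffunE /= unlift_none. Qed.

Lemma hor_add_rowS i k : hor (add_row h v s) (lift ord0 i) k = hor s i k.
Proof. by rewrite /hor ffunE /= liftK. Qed.

Lemma ver_add_row0 j : ver (add_row h v s) j 0 = tnth v j.
Proof.
rewrite /ver ffunE /= (_ : inord 0 = ord0) ?unlift_none //.
by apply: val_inj; rewrite /= inordK.
Qed.

Lemma ver_add_rowS j k : (k <= r)%N -> ver (add_row h v s) j k.+1 = ver s j k.
Proof.
move=> kr; rewrite /ver ffunE /= (_ : inord k.+1 = lift ord0 (inord k)) ?liftK //.
by apply: val_inj; rewrite /= !inordK.
Qed.

Lemma sv_valid_add_row top :
  sv_valid top (add_row h v s)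
  = [&& [forall j, tnth v j == top j], nth false h 0,
     ice_row (nth false h 0) (mkseq top c) (first_row s) (behead h)
     & sv_valid (nth false (first_row s)) s].
Proof.
rewrite /sv_valid !forall_ord_recl !hor_add_row0.
have nthh k : (k <= c)%N -> tnth h (inord k) = nth false h k.
  by move=> kc; rewrite (tnth_nth false) inordK.
rewrite !nthh //.
have -> : [forall i, hor (add_row h v s) (lift ord0 i) 0 && ~~ hor (add_row h v s) (lift ord0 i) c]
  = [forall i, hor s i 0 && ~~ hor s i c].
  by apply: eq_forallb => i; rewrite !hor_add_rowS.
have -> : [forall i : 'I_r, forall j, in_count (add_row h v s) (lift ord0 i) j == 2]
  = [forall i, forall j, in_count s i j == 2].
  apply: eq_forallb => i; apply: eq_forallb => j.
  by rewrite /in_count lift0 !hor_add_rowS !ver_add_rowS // ltnW.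
rewrite !forall_and.
have -> : [forall j, ~~ ver (add_row h v s) j r.+1] = [forall j, ~~ ver s j r].
  by apply: eq_forallb => j; rewrite ver_add_rowS.
have -> : [forall j, ver (add_row h v s) j 0 == top j] = [forall j, tnth v j == top j].
  by apply: eq_forallb => j; rewrite ver_add_row0.
have -> : [forall j, ver s j 0 == nth false (first_row s) j].
  by apply/forallP => j; rewrite -tnth_nth tnth_mktuple.
have [/forallP vtop|] := boolP [forall j, tnth v j == top j]; last by rewrite !(andbF, andFb).
have -> : ice_row (nth false h 0) (mkseq top c) (first_row s) (behead h)
  = ~~ nth false h c && [forall j, in_count (add_row h v s) ord0 j == 2].
  rewrite (@ice_rowP _ c) ?size_mkseq ?size_tuple ?size_behead //.
  rewrite (_ : _ :: behead h = h :> seq bool); last by case: (tupleP h).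
  congr (_ && _).
  have local (j : 'I_c) : (nth false h j + nth false (first_row s) j
      == nth false (mkseq top c) j + nth false h j.+1)%N
    = (in_count (add_row h v s) ord0 j == 2%N) :> bool.
    rewrite /in_count !hor_add_row0 ver_add_row0 ver_add_rowS //.
    rewrite (nthh j (ltnW (ltn_ord j))) (nthh j.+1 (ltn_ord j)).
    rewrite nth_mkseq // -tnth_nth tnth_mktuple (eqP (vtop j)).
    by case: (nth false h j); case: (nth false h j.+1); case: (top j); case: (ver _ _ _).
  apply/allP/forallP => [H j|H j].
    by rewrite -local; apply: H; rewrite mem_iota add0n ltn_ord.
  by rewrite mem_iota add0n => /andP[_ jc]; rewrite -[j]/(val (Ordinal jc)) local.
rewrite andTb !andbT -!andbA; congr (_ && _).
by do ![case: [forall _, _] => /=] => //; rewrite ?andbF.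
Qed.
End AddRow.
End States.

Section CountIce.
Variables (R : comNzRingType) (mu : R).

(** Without rows the top edges are also the bottom edges, so the only candidate has all arrows
    down. *)
Lemma sv_count0 c top : sv_count 0 c top = all (fun j => ~~ top j) (iota 0 c) :> nat.
Proof.
have [/allP topF|/allPn[j]] := boolP (all _ _); last first.
  rewrite mem_iota /= add0n => jc /negPn topj; apply: eq_card0 => s.
  apply/negbTE/negP => /andP[/andP[_ /forallP H] _].
  by have /andP[/negPf -> /eqP top0] := H (Ordinal jc); rewrite /= -top0 in topj.
pose s0 : sv_state 0 c := ([ffun=> false], [ffun=> false]).
apply: (@eq_card1 _ s0) => s; rewrite !inE; apply/idP/eqP => [|->].
  move=> /andP[/andP[_ /forallP H] _]; case: s H => s1 s2 H.
  congr pair; apply/ffunP => -[i k]; first by case: i.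
  have /andP[+ _] := H i; rewrite /ver /= ffunE => /negbTE <-.
  by congr (s2 (_, _)); apply: val_inj; rewrite /= inordK //; case: k => -[].
apply/andP; split; last by apply/forallP => -[].
apply/andP; split; first by apply/forallP => -[].
apply/forallP => j; rewrite /ver /= !ffunE /= eq_sym eqbF_neg topF //.
by rewrite mem_iota /= ltn_ord.
Qed.

Lemma sv_countS r c top :
  (sv_count r.+1 c top)%:R = \sum_(v : c.-tuple bool) \sum_(hs : c.-tuple bool)
    (ice_row true (mkseq top c) v hs)%:R * (sv_count r c (nth false v))%:R :> R.
Proof.
have cardE r' top' : (sv_count r' c top')%:R = \sum_(s : sv_state r' c) (sv_valid top' s)%:R :> R.
  by rewrite /sv_count -sum1_card natr_sum big_mkcond /=; apply: eq_bigr => s _;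
    rewrite inE; case: (sv_valid _ _).
rewrite cardE (reindex _ (onW_bij _ (add_row_bij r c))) /=.
under eq_bigr => p _ do rewrite sv_valid_add_row.
rewrite -(pair_bigA _ (fun (hv : c.+1.-tuple bool * c.-tuple bool) s =>
  [&& [forall j, tnth hv.2 j == top j], nth false hv.1 0,
     ice_row (nth false hv.1 0) (mkseq top c) (first_row s) (behead hv.1)
     & sv_valid (nth false (first_row s)) s]%:R)) /=.
rewrite exchange_big.
under [RHS]eq_bigr => v _ do under eq_bigr => hs _ do rewrite cardE mulr_sumr.
under [RHS]eq_bigr => v _ do rewrite exchange_big.
rewrite [RHS]exchange_big; apply: eq_bigr => s _ /=.
rewrite -(pair_bigA _ (fun (h : c.+1.-tuple bool) (v : c.-tuple bool) =>
  [&& [forall j, tnth v j == top j], nth false h 0,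
     ice_row (nth false h 0) (mkseq top c) (first_row s) (behead h)
     & sv_valid (nth false (first_row s)) s]%:R)) /=.
rewrite exchange_big /=.
rewrite (bigD1 [tuple top j | j < c]) //= [X in _ + X]big1 ?addr0 => [|v vtop]; last first.
  rewrite big1 // => h _; case: forallP => // H; case/eqP: vtop.
  by apply: eq_from_tnth => j; rewrite tnth_mktuple; apply/eqP.
rewrite (_ : [forall j, _] = true); last by apply/forallP => j; rewrite tnth_mktuple.
rewrite [RHS](bigD1 (first_row s)) //= [X in _ = _ + X]big1 ?addr0 => [|v vs]; last first.
  rewrite big1 // => hs _; rewrite (_ : sv_valid _ s = false) ?mulr0 //.
  apply: contraNF vs => /andP[/andP[_ /forallP H] _]; apply/eqP.
  by apply: eq_from_tnth => j; have /andP[_ /eqP] := H j; rewrite tnth_mktuple -tnth_nth.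
rewrite (sum_tuple_cons _ (fun h => [&& nth false h 0,
     ice_row (nth false h 0) (mkseq top c) (first_row s) (behead h)
     & sv_valid (nth false (first_row s)) s]%:R)) big_bool /=.
rewrite [X in _ + X]big1 // addr0; apply: eq_bigr => hs _.
by rewrite -natrM mulnb.
Qed.

Lemma sv_count_ice r c top :
  (sv_count r c top)%:R = ice mu (all_right (nseq r 1)) (nseq c 1) (mkseq top c) :> R.
Proof.
elim: r top => [|r IH] top.
  rewrite sv_count0 /ice /= /down /mkseq all_map; congr (nat_of_bool _)%:R.
rewrite sv_countS [RHS](rowop_count mu) ?size_mkseq //.
apply: eq_bigr => v _; apply: eq_bigr => hs _; rewrite IH; congr (_ * ice _ _ _ _).
apply: (@eq_from_nth _ false) => [|i]; rewrite size_mkseq ?size_tuple // => ic.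
by rewrite nth_mkseq.
Qed.
End CountIce.

(** * Reduction of the boundary condition to refined counts *)

Lemma up_colE n m d i :
  up_col n.+1 (lam_md n.+1 m d) i = (i == m + d + n.+1)%N || (d < i <= d + n)%N.
Proof.
rewrite /up_col /lam_md /= subn0; congr (_ || _).
apply/hasP/idP => [[k]|/andP[di idn]].
  rewrite mem_iota => /andP[]; case: k => // k _ kn /eqP ->.
  by rewrite add1n ltnS in kn; rewrite /= nth_nseq kn; lia.
exists (d + n.+1 - i)%N; first by rewrite mem_iota; lia.
have -> : (d + n.+1 - i = (d + n - i).+1)%N by lia.
rewrite /= nth_nseq; case: ifP => [_|]; last by move/negbT; lia.
by apply/eqP; lia.
Qed.

Lemma top_row_lam_md n m d :
  let N := (n.+1 + (m + d))%N in
  mkseq (fun j => up_col n.+1 (lam_md n.+1 m d) (N - j)) N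
  = true :: (nseq m false ++ nseq n true) ++ nseq d false.
Proof.
move=> N; apply: (@eq_from_nth _ false).
  by rewrite size_mkseq /= !size_cat !size_nseq /N; lia.
rewrite size_mkseq => -[|j] jN; rewrite nth_mkseq // up_colE.
  by rewrite subn0 /N /=; apply/orP; left; apply/eqP; lia.
rewrite /= !nth_cat !size_cat !size_nseq !nth_nseq /N.
have [jm|mj] := ltnP j m.
  by rewrite ltn_addr //; apply/negbTE; lia.
have [jmn|mnj] := ltnP j (m + n).
  by rewrite ltn_subLR // jmn; lia.
by rewrite if_same; apply/negbTE; lia.
Qed.

Section LamCount.
Variables (R : comNzRingType) (mu : R).

(** Under down arrows a right arrow can never turn left again, as the right boundary demands. Hence
    the last [d] columns are crossed by left arrows only and have no effect on the count. *)
Lemma rowop1_false_tail h d f :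
  rowop mu 1 h false (nseq d 1) f (nseq d false) = (~~ h)%:R * f (nseq d false).
Proof.
have e1 : mu * 1 + (1 - mu) * 1 = 1 by ring.
have T g k : rowop mu 1 true false (nseq k 1) g (nseq k false) = 0.
  by elim: k g => // k IH g; rewrite rowop_TF IH mulr0.
case: h; first by rewrite T mul0r.
elim: d f => [|d IH] f; first by rewrite mul1r.
by rewrite rowop_FF T mulr0 addr0 IH e1 mul1r.
Qed.

Lemma rowop1_cat_false h c d f u : size u = c ->
  rowop mu 1 h false (nseq c 1 ++ nseq d 1) f (u ++ nseq d false)
  = rowop mu 1 h false (nseq c 1) (fun v => f (v ++ nseq d false)) u.
Proof.
elim: c h f u => [|c IH] h f [|e u] //= => [_|[su]].
  by rewrite rowop1_false_tail; case: h; rewrite ?mul0r ?mul1r.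
by apply: eq_bigr => h' _; apply: eq_bigr => e' _; rewrite IH.
Qed.

Lemma ice1_cat_false r c d u : size u = c ->
  ice mu (all_right (nseq r 1)) (nseq c 1 ++ nseq d 1) (u ++ nseq d false)
  = ice mu (all_right (nseq r 1)) (nseq c 1) u.
Proof.
elim: r u => [|r IH] u su.
  by rewrite /ice /= /down all_cat all_nseq orbT andbT.
rewrite [LHS]rowop1_cat_false //; by apply: eq_rowop_size; rewrite size_nseq.
Qed.

Lemma sum_bin_hockey p j : (\sum_(0 <= k < j.+1) 'C(p + k, p) = 'C(p.+1 + j, p.+1))%N.
Proof.
elim: j => [|j IH]; first by rewrite big_nat1 !addn0 !binn.
by rewrite big_nat_recr // IH [(p.+1 + j.+1)%N]addnS binS addSnnS.
Qed.

(** By [ice_one_left_F] the arrow moves weakly down, so exchanging the sums leaves partial sums of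
    binomials, which the hockey-stick identity evaluates. *)
Lemma sum_one_left_F n p ys u :
  \sum_(0 <= k < n) 'C(p + k, p)%:R * ice mu (one_left k (nseq n 1)) (1 :: ys) (false :: u)
  = \sum_(0 <= k < n) 'C(p.+1 + k, p.+1)%:R * ice mu (one_left k (nseq n 1)) ys u.
Proof.
transitivity (\sum_(0 <= k < n) \sum_(0 <= j < n | (k <= j)%N)
   'C(p + k, p)%:R * ice mu (one_left j (nseq n 1)) ys u).
  rewrite big_seq [RHS]big_seq; apply: eq_bigr => k; rewrite mem_index_iota => /andP[_ kn].
  by rewrite ice_one_left_F // mulr_sumr (@big_nat_widenl _ _ _ _ 0).
rewrite (exchange_big_dep xpredT) //= big_seq [RHS]big_seq; apply: eq_bigr => j.
rewrite mem_index_iota => /andP[_ jn].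
rewrite -sum_bin_hockey natr_sum mulr_suml [RHS](big_nat_widen _ _ n) //.
Qed.

Lemma ice_one_left_Fs n m p ys u :
  \sum_(0 <= k < n) 'C(p + k, p)%:R
     * ice mu (one_left k (nseq n 1)) (nseq m 1 ++ ys) (nseq m false ++ u)
  = \sum_(0 <= k < n) 'C(m + p + k, m + p)%:R * ice mu (one_left k (nseq n 1)) ys u.
Proof.
elim: m p => //= m IH p.
by rewrite sum_one_left_F IH addnS.
Qed.
End LamCount.

Lemma A_lam_md_refined (C : numFieldType) (mu : C) n m d :
  (A_lam n.+1 (lam_md n.+1 m d))%:R
  = \sum_(0 <= j < n.+1) 'C(m + j, m)%:R * refined_count mu n j :> C.
Proof.
rewrite /A_lam /= (sv_count_ice mu).
have := top_row_lam_md n m d; cbv zeta => ->.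
have -> : nseq (n.+1 + (m + d)) (1 : C) = nseq (1 + m + n) 1 ++ nseq d 1.
  by rewrite -nseqD; congr nseq; lia.
rewrite -cat_cons ice1_cat_false; last by rewrite /= size_cat !size_nseq.
have -> : nseq (1 + m + n) (1 : C) = 1 :: nseq m 1 ++ nseq n 1 by rewrite -nseqD.
rewrite ice_T1; have := ice_one_left_Fs mu n.+1 m 0 (nseq n 1) (nseq n true).
rewrite addn0 => <-; apply: eq_bigr => j _.
by rewrite bin0 mul1r.
Qed.

(** * Normalisation and the closed forms *)

Lemma natr_bin_neq0 (F : numFieldType) n k : (k <= n)%N -> 'C(n, k)%:R != 0 :> F.
Proof. by move=> kn; rewrite pnatr_eq0 -lt0n bin_gt0. Qed.

Lemma natr_fact_neq0 (F : numFieldType) n : n`!%:R != 0 :> F.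
Proof. by rewrite pnatr_eq0 -lt0n fact_gt0. Qed.

Lemma ASM_S n : ASM n.+1 * 'C(2 * n, n)%:R = ASM n * 'C((3 * n).+1, n)%:R.
Proof.
have f0 := natr_fact_neq0 rat.
pose D m : rat := \prod_(j < m) (m + j)`!%:R.
have D0 m : D m != 0 by apply/prodf_neq0 => j _.
(* Both sides are the product of the factorials from [m] to [(2 * m).+1], split off at either
   end. *)
have DS m : D m.+1 * m`!%:R = D m * ((2 * m)`!%:R * (2 * m).+1`!%:R).
  rewrite mulrC /D.
  transitivity (\prod_(j < m.+2) (m + j)`!%:R : rat).
    rewrite [RHS]big_ord_recl addn0; congr (_ * _); apply: eq_bigr => j _.
    by rewrite lift0 addSnnS.
  rewrite !big_ord_recr /= -mulrA; congr (_ * (_%:R * _%:R)); congr (_`!); lia.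
have b1 : 'C(2 * n, n)%:R * (n`!%:R * n`!%:R) = (2 * n)`!%:R :> rat.
  have le : (n <= 2 * n)%N by lia.
  by rewrite -!natrM -(bin_fact le); congr (_ * (_ * _`!))%:R; lia.
have b2 : 'C((3 * n).+1, n)%:R * (n`!%:R * (2 * n).+1`!%:R) = (3 * n).+1`!%:R :> rat.
  have le : (n <= (3 * n).+1)%N by lia.
  by rewrite -!natrM -(bin_fact le); congr (_ * (_ * _`!))%:R; lia.
have E m : ASM m = (\prod_(j < m) (3 * j).+1`!%:R) / D m by rewrite /ASM prodf_div.
rewrite !E big_ord_recr /= -b2.
apply: (mulIf (D0 n.+1)); apply: (mulIf (f0 n)).
rewrite -[RHS]mulrA DS -b1.
move: (D n) (D n.+1) (D0 n) (D0 n.+1) (\prod_(j < n) _) ('C(2 * n, n)%:R : rat)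
  ('C(_, _)%:R : rat) (n`!%:R : rat) ((2 * n).+1`!%:R : rat).
move=> d0 d1 nd0 nd1 p c1 c2 f1 f2.
by field; rewrite nd0 nd1.
Qed.

(** Sorts the subsets with [p + q + 1] elements of [M.+1] points by the position [i] of the element
    preceded by exactly [p] others. *)
Lemma sum_bin_bin M p q :
  (\sum_(i < M.+1) 'C(i, p) * 'C(M - i, q) = 'C(M.+1, (p + q).+1))%N.
Proof.
elim: M p q => [|M IH] p [|q].
- by rewrite big_ord1 addn0 muln1; case: p.
- by rewrite big_ord1 muln0 bin_small // addnS.
- have {}IH := IH p 0%N; rewrite big_ord_recr /= bin0 muln1 addn0 [RHS]binS.
  rewrite -[in 'C(M.+1, p.+1)](addn0 p) -IH.
  by congr (_ + _)%N; apply: eq_bigr => i _; rewrite !bin0.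
rewrite big_ord_recr /= subnn muln0 addn0.
rewrite binS [in X in _ = (_ + X)%N]addnS -!IH -big_split /=.
apply: eq_bigr => i _; rewrite -mulnDr; congr (_ * _)%N.
by rewrite subSn ?leq_ord // binS.
Qed.

(** This is [sum_bin_bin] at [M = 3 * n] with [i = n + k]; the terms with [i] outside
    [n, ..., 2 * n] vanish. *)
Lemma sum_bin_refined n p :
  (\sum_(k < n.+1) 'C(n + k, n + p) * 'C(2 * n - k, n)
   = 'C((3 * n).+1, (2 * n + p).+1))%N.
Proof.
rewrite (_ : 2 * n + p = n + p + n)%N; last by lia.
rewrite -sum_bin_bin -(big_mkord xpredT (fun i => 'C(i, n + p) * 'C(3 * n - i, n))%N).
rewrite (@big_cat_nat _ _ _ n) //=; last by lia.
rewrite [X in _ = (X + _)%N]big1_seq ?add0n => [|i]; last first.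
  by rewrite mem_index_iota => /andP[_ /andP[_ ni]]; rewrite bin_small // ltn_addr.
rewrite (@big_cat_nat _ _ _ (2 * n).+1) //=; [|lia|lia].
rewrite [X in _ = (_ + X)%N]big1_seq ?addn0 => [|i]; last first.
  rewrite mem_index_iota => /andP[_ /andP[ni n3i]].
  by rewrite [X in (_ * X)%N]bin_small ?muln0 //; lia.
rewrite -[X in index_iota X _]add0n big_addn (_ : (2 * n).+1 - n = n.+1)%N ?big_mkord;
  last by lia.
by apply: eq_bigr => -[k kn] _ /=; congr ('C(_, _) * 'C(_, _))%N; lia.
Qed.

Section Normalisation.
Variables (C : numFieldType) (mu : C).
Hypothesis muP : 3 * mu * (1 - mu) = 1.

Lemma asm_total_refined0 n :
  asm_total mu n * 'C(2 * n, n)%:R = refined_count mu n 0 * 'C((3 * n).+1, n)%:R.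
Proof.
rewrite /asm_total mulr_suml.
have := sum_bin_refined n 0; rewrite !addn0 => e.
have -> : 'C((3 * n).+1, n) = 'C((3 * n).+1, (2 * n).+1).
  have le : (n <= (3 * n).+1)%N by lia.
  by rewrite -(bin_sub le); congr ('C(_, _)); lia.
rewrite -e natr_sum mulr_sumr; apply: eq_bigr => -[k kn] _.
by rewrite refined_ratio.
Qed.

Lemma asm_total_ASM n : asm_total mu n = ratr (ASM n.+1).
Proof.
have c0 m : 'C(2 * m, m)%:R != 0 :> C by apply: natr_bin_neq0; lia.
elim: n => [|n IH].
  apply: (mulIf (c0 0)); rewrite asm_total_refined0.
  by rewrite refined_count00 /ASM big_ord1 divff ?rmorph1.
apply: (mulIf (c0 n.+1)); rewrite asm_total_refined0.
have := congr1 (@ratr C) (ASM_S n.+1); rewrite !rmorphM !rmorph_nat /= => ->.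
by rewrite refined_countS0 // IH.
Qed.

Lemma refined_count_ASM n k : (k <= n)%N ->
  refined_count mu n k = ratr (ASM n.+1 / 'C((3 * n).+1, n)%:R
                         * ('C(n + k, n) * 'C(2 * n - k, n))%:R).
Proof.
move=> kn; have c0 : 'C(2 * n, n)%:R != 0 :> C by apply: natr_bin_neq0; lia.
have c1 : 'C((3 * n).+1, n)%:R != 0 :> C by apply: natr_bin_neq0; lia.
apply: (mulIf c0); rewrite refined_ratio // !rmorphM fmorphV !rmorph_nat /= -asm_total_ASM.
rewrite [RHS]mulrAC [_ / _ * _]mulrAC asm_total_refined0.
by rewrite mulfK.
Qed.
End Normalisation.

Lemma mu_exists : exists mu : algC, 3 * mu * (1 - mu) = 1.
Proof.
have [mu mu2] := @solve_monicpoly algC 2 (fun i => if i == 0%N then - 3^-1 else 1) isT.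
exists mu; move: mu2; rewrite !big_ord_recl big_ord0 /= addr0 expr0 mulr1 mul1r expr1 => mu2.
transitivity (3 * (mu - mu ^+ 2)); first by ring.
by rewrite mu2; field.
Qed.

Lemma A_lam_md_sum n m d :
  (A_lam n.+1 (lam_md n.+1 m d))%:R = ASM n.+1 / 'C((3 * n).+1, n)%:R
   * \sum_(k < n.+1) ('C(m + k, m) * 'C(n + k, n) * 'C(2 * n - k, n))%:R.
Proof.
have [mu muP] := mu_exists.
(* The weights need a non-real [mu], but both sides are rational, so they may be compared in
   [algC]. *)
apply: (fmorph_inj (ratr : rat -> algC)).
rewrite /= ratr_nat (A_lam_md_refined mu) big_mkord mulr_sumr rmorph_sum.
apply: eq_bigr => k _.
rewrite (refined_count_ASM muP (leq_ord k)) -(ratr_nat algC) -rmorphM; congr (ratr _).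
by rewrite mulrCA -natrM mulnA.
Qed.

Lemma bin_mul_bin n j k : ('C(n + j, n) * 'C(j, k) = 'C(n + j, n + k) * 'C(n + k, k))%N.
Proof.
have [kj|jk] := leqP k j; last first.
  by rewrite (bin_small jk) (@bin_small (n + j) (n + k)) ?ltn_add2l // muln0.
have D0 : (0 < n`! * k`! * (j - k)`!)%N by rewrite !muln_gt0 !fact_gt0.
apply/eqP; rewrite -(eqn_pmul2r D0); apply/eqP.
have e1 : ('C(n + j, n) * (n`! * j`!) = (n + j)`!)%N.
  by rewrite -[in RHS](bin_fact (leq_addr j n)) addKn.
have e2 := bin_fact kj.
have e3 : ('C(n + j, n + k) * ((n + k)`! * (j - k)`!) = (n + j)`!)%N.
  have le : (n + k <= n + j)%N by rewrite leq_add2l.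
  by rewrite -(bin_fact le) subnDl.
have e4 : ('C(n + k, k) * (k`! * n`!) = (n + k)`!)%N.
  by rewrite -[in RHS](bin_fact (leq_addl n k)) addnK.
transitivity (n + j)`!; first by rewrite -{1}e1 -{1}e2; ring.
by rewrite -{1}e3 -{1}e4; ring.
Qed.

Lemma bin_vandermonde_sum m j : 'C(m + j, m) = (\sum_(0 <= k < m.+1) 'C(m, k) * 'C(j, k))%N.
Proof.
rewrite addnC -binomial.Vandermonde big_mkord; apply: eq_bigr => -[k km] _ /=.
by rewrite mulnC bin_sub.
Qed.

(* The [k]-th term of the second sum of the theorem, without ['C(m, k)]. *)
Definition ratio_term n k : rat :=
  if (k < n.+1)%N then
    ((n.+1 + k - 1)`! * (2 * n.+1 - 1)`!)%:R
    / (k`! * (n.+1 - k - 1)`! * (2 * n.+1 + k - 1)`!)%:R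
  else 0.

Lemma ratio_termE n k : ratio_term n k * 'C((3 * n).+1, n)%:R
  = ('C((3 * n).+1, (2 * n + k).+1) * 'C(n + k, k))%:R.
Proof.
rewrite /ratio_term ltnS; have [kn|nk] := leqP k n; last first.
  by rewrite mul0r [X in (X * _)%N]bin_small ?mul0n //; lia.
have -> : (n.+1 + k - 1 = n + k)%N by lia.
have -> : (2 * n.+1 - 1 = (2 * n).+1)%N by lia.
have -> : (n.+1 - k - 1 = n - k)%N by lia.
have -> : (2 * n.+1 + k - 1 = (2 * n + k).+1)%N by lia.
have d0 : (k`! * (n - k)`! * (2 * n + k).+1`!)%:R != 0 :> rat.
  by rewrite pnatr_eq0 -lt0n !muln_gt0 !fact_gt0.
apply: (mulIf d0); rewrite mulrAC divfK // -!natrM; congr (_%:R).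
have D0 : (0 < n`!)%N by rewrite fact_gt0.
apply/eqP; rewrite -(eqn_pmul2r D0); apply/eqP.
have e1 : ('C((3 * n).+1, n) * (n`! * (2 * n).+1`!) = (3 * n).+1`!)%N.
  have le : (n <= (3 * n).+1)%N by lia.
  by rewrite -(bin_fact le); congr (_ * (_ * _`!))%N; lia.
have e2 : ('C((3 * n).+1, (2 * n + k).+1) * ((2 * n + k).+1`! * (n - k)`!) = (3 * n).+1`!)%N.
  have le : ((2 * n + k).+1 <= (3 * n).+1)%N by lia.
  by rewrite -(bin_fact le); congr (_ * (_ * _`!))%N; lia.
have e4 : ('C(n + k, k) * (k`! * n`!) = (n + k)`!)%N.
  by rewrite -[in RHS](bin_fact (leq_addl n k)) addnK.
transitivity ((n + k)`! * (3 * n).+1`!)%N; first by rewrite -{1}e1; ring.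
by rewrite -{1}e2 -{1}e4; ring.
Qed.

(** Vandermonde expands ['C(m + j, m)], [bin_mul_bin] absorbs the resulting ['C(j, k)], and
    [sum_bin_refined] sums over [j]. *)
Lemma A_lam_md_ratio_sum n m d :
  (A_lam n.+1 (lam_md n.+1 m d))%:R
  = ASM n.+1 * \sum_(0 <= k < m.+1) 'C(m, k)%:R * ratio_term n k.
Proof.
have c0 : 'C((3 * n).+1, n)%:R != 0 :> rat by apply: natr_bin_neq0; lia.
rewrite A_lam_md_sum -mulrA; congr (_ * _); apply: (mulfI c0); rewrite mulVKf //.
under eq_bigr => j _ do rewrite bin_vandermonde_sum !big_distrl /=.
rewrite -natr_sum exchange_big /= mulr_sumr natr_sum; apply: eq_bigr => k _.
rewrite mulrCA [_ * ratio_term _ _]mulrC ratio_termE -natrM; congr (_%:R).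
rewrite -sum_bin_refined big_distrl big_distrr /=; apply: eq_bigr => j _.
transitivity ('C(m, k) * ('C(n + j, n) * 'C(j, k)) * 'C(2 * n - j, n))%N; first by ring.
by rewrite bin_mul_bin; ring.
Qed.

(** * The quotient of polynomials in the size *)

Lemma prod_rising_fact a k : ((\prod_(i < k) (a.+1 + i)) * a`! = (a + k)`!)%N.
Proof.
elim: k => [|k IH]; first by rewrite big_ord0 mul1n addn0.
by rewrite big_ord_recr /= mulnAC IH addnS factS mulnC addSn.
Qed.

Lemma natr_frac_mul (N D a b : nat) : D != 0%N -> (N * a = b * D)%N ->
  N%:R / D%:R * a%:R = b%:R :> rat.
Proof.
move=> D0 e; have d0 : D%:R != 0 :> rat by rewrite pnatr_eq0.
by apply: (mulIf d0); rewrite mulrAC divfK // -!natrM e.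
Qed.

(** Cancelling factorials leaves products of [k] factors. For [k > n] the last product contains the
    factor 0, in agreement with the default value of [ratio_term]. *)
Lemma ratio_term_prod n k :
  ratio_term n k * k`!%:R * \prod_(i < k) (2 * n.+1%:R + i%:R)
  = \prod_(i < k) (n.+1%:R + i%:R) * \prod_(i < k) (n.+1%:R - i.+1%:R).
Proof.
have -> : \prod_(i < k) (2 * n.+1%:R + i%:R) = (\prod_(i < k) ((2 * n).+1.+1 + i))%:R :> rat.
  rewrite natr_prod; apply: eq_bigr => i _; rewrite -natrM -natrD; congr (_%:R); lia.
have -> : \prod_(i < k) (n.+1%:R + i%:R) = (\prod_(i < k) (n.+1 + i))%:R :> rat.
  by rewrite natr_prod; apply: eq_bigr => i _; rewrite -natrD.
rewrite /ratio_term ltnS; have [kn|nk] := leqP k n; last first.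
  by rewrite !mul0r [X in _ = _ * X](bigD1 (Ordinal nk)) //= subrr mul0r mulr0.
have -> : \prod_(i < k) (n.+1%:R - i.+1%:R) = (n ^_ k)%:R :> rat.
  rewrite ffact_prod natr_prod; apply: eq_bigr => -[i ik] _ /=.
  by rewrite -natrB ?subSS //; lia.
have -> : (n.+1 + k - 1 = n + k)%N by lia.
have -> : (2 * n.+1 - 1 = (2 * n).+1)%N by lia.
have -> : (n.+1 - k - 1 = n - k)%N by lia.
have -> : (2 * n.+1 + k - 1 = (2 * n).+1 + k)%N by lia.
rewrite -mulrA -!natrM; apply: natr_frac_mul.
  by rewrite -lt0n !muln_gt0 !fact_gt0.
have D0 : (0 < n`! * (2 * n).+1`!)%N by rewrite muln_gt0 !fact_gt0.
apply/eqP; rewrite -(eqn_pmul2r D0); apply/eqP.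
rewrite -(prod_rising_fact n k) -(prod_rising_fact (2 * n).+1 k) -(ffact_fact kn).
move: (\prod_(i < k) (n.+1 + i))%N (\prod_(i < k) _)%N ((2 * n).+1`!) => p1 p2 b.
by ring.
Qed.

(** Even [i = 2 * l] contribute [2 * (x + l)], odd [i = 2 * l + 1] contribute
    [2 * (x + l + 1/2)]. *)
Lemma prod_double_parity (x : rat) k :
  \prod_(i < k) (2 * x + i%:R) = 2 ^+ k * \prod_(l < uphalf k) (x + l%:R)
    * \prod_(l < k./2) (x + l%:R + 2^-1).
Proof.
elim: k => [|k IH]; first by rewrite !big_ord0 !mulr1.
have ke : k%:R = (odd k)%:R + k./2%:R * 2 :> rat.
  by rewrite -natrM -natrD muln2 odd_double_half.
rewrite big_ord_recr /= {}IH exprS {}ke uphalf_half.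
case: (odd k) => /=; rewrite ?add0n ?add1n.
  by rewrite [X in _ = _ * X]big_ord_recr /=; field.
by rewrite [in RHS]big_ord_recr /=; ring.
Qed.

(* The even factors [2x + 2l] of [prod_(i < k) (2x + i)] cancel against
   [prod_(i < k) (x + i)], so that the odd ones suffice as common denominator. *)
Definition numer_roots m k : seq rat :=
  [seq i.+1%:R | i <- iota 0 k] ++ [seq - l%:R | l <- iota (uphalf k) k./2]
  ++ [seq - (l%:R + 2^-1) | l <- iota k./2 (m./2 - k./2)].

Definition numer m : {poly rat} :=
  \sum_(k < m.+1) ('C(m, k)%:R / (k`!%:R * 2 ^+ k)) *: \prod_(c <- numer_roots m k) ('X - c%:P).

Definition denom m : {poly rat} :=
  \prod_(c <- [seq - (l%:R + 2^-1) | l <- iota 0 m./2]) ('X - c%:P).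

Lemma size_numer_roots m k : (k <= m)%N -> size (numer_roots m k) = (k + m./2)%N.
Proof.
move=> km; rewrite !size_cat !size_map !size_iota subnKC //.
exact: half_leq.
Qed.

(** The [k]-th summand has degree [k + m./2], so the leading term comes from [k = m] alone. *)
Lemma size_numer m : size (numer m) = (m + m./2).+1.
Proof.
rewrite /numer big_ord_recr /= addrC size_polyDl.
  rewrite size_scale ?size_prod_XsubC ?size_numer_roots //.
  by rewrite mulf_neq0 ?invr_neq0 ?mulf_neq0 ?natr_fact_neq0 ?natr_bin_neq0 ?expf_neq0.
rewrite size_scale; last first.
  by rewrite mulf_neq0 ?invr_neq0 ?mulf_neq0 ?natr_fact_neq0 ?natr_bin_neq0 ?expf_neq0.
rewrite size_prod_XsubC size_numer_roots // ltnS.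
rewrite (leq_trans (size_sum _ _ _)) //; apply/bigmax_leqP => -[k km] _ /=.
rewrite (leq_trans (size_scale_leq _ _)) // size_prod_XsubC size_numer_roots ?(ltnW km) //.
by rewrite ltn_add2r.
Qed.

Lemma size_denom m : size (denom m) = (m./2).+1.
Proof. by rewrite size_prod_XsubC size_map size_iota. Qed.

Lemma denom_neq0 m n : (denom m).[n.+1%:R] != 0.
Proof.
rewrite horner_prod big_map prodf_seq_neq0; apply/allP => l _ /=.
by rewrite hornerXsubC opprK gt_eqF // addr_gt0 ?ltr0n // ltr_wpDl ?ler0n ?invr_gt0.
Qed.

Lemma ratio_term_horner m n k : (k <= m)%N ->
  ratio_term n k = (k`!%:R * 2 ^+ k)^-1 * \prod_(c <- numer_roots m k) (n.+1%:R - c)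
            / (denom m).[n.+1%:R].
Proof.
move=> km; have d0 := denom_neq0 m n.
have k0 : k`!%:R * 2 ^+ k != 0 :> rat by rewrite mulf_neq0 ?natr_fact_neq0 ?expf_neq0.
apply: (mulIf d0); rewrite divfK //; apply: (mulfI k0); rewrite mulVKf //.
pose x : rat := n.+1%:R; rewrite -/x.
(* The factors shared by the numerator and the even part of the denominator; they are positive, so
   they can be cancelled. *)
pose U := \prod_(l < uphalf k) (x + l%:R).
have U0 : U != 0 by apply/prodf_neq0 => l _; rewrite gt_eqF // ltr_wpDr ?ler0n ?ltr0n.
apply: (mulfI U0).
have iotaE a b (F : nat -> rat) : (a <= b)%N ->
    \prod_(l < b) F l = \prod_(l < a) F l * \prod_(l <- iota a (b - a)) F l.
  move=> ab; rewrite -!(big_mkord xpredT F) /index_iota !subn0.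
  by rewrite -{1}(subnKC ab) iotaD big_cat.
have dE : (denom m).[x] = \prod_(l < k./2) (x + l%:R + 2^-1)
    * \prod_(l <- iota k./2 (m./2 - k./2)) (x + l%:R + 2^-1).
  rewrite -(iotaE _ _ (fun l => x + l%:R + 2^-1)) ?half_leq //.
  rewrite horner_prod big_map -(big_mkord xpredT (fun l => x + l%:R + 2^-1)) /index_iota subn0.
  by apply: eq_bigr => l _; rewrite hornerXsubC opprK addrA.
have nE : \prod_(c <- numer_roots m k) (x - c) = \prod_(i < k) (x - i.+1%:R)
    * (\prod_(l <- iota (uphalf k) k./2) (x + l%:R)
       * \prod_(l <- iota k./2 (m./2 - k./2)) (x + l%:R + 2^-1)).
  rewrite !big_cat !big_map -(big_mkord xpredT (fun i => x - i.+1%:R)) /index_iota subn0 /=.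
  congr (_ * (_ * _)); apply: eq_bigr => l _; rewrite ?opprK ?addrA //.
have uk : (uphalf k <= k)%N by rewrite uphalf_half -{2}(odd_double_half k); lia.
have := ratio_term_prod n k; rewrite prod_double_parity -/x -/U.
rewrite (iotaE _ _ (fun l => x + l%:R) uk) -/U.
rewrite (_ : (k - uphalf k = k./2)%N); last by rewrite uphalf_half -{1}(odd_double_half k); lia.
rewrite dE nE => e.
transitivity (U * \prod_(l <- iota (uphalf k) k./2) (x + l%:R) * \prod_(i < k) (x - i.+1%:R)
   * \prod_(l <- iota k./2 (m./2 - k./2)) (x + l%:R + 2^-1)); last by ring.
by rewrite -e; ring.
Qed.

Theorem theorem4 (m : nat) :
  (forall n d : nat, (1 <= n)%N ->
     ((A_lam n (lam_md n m d))%:R : rat)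
       = ASM n / ('C(3 * n - 2, n - 1))%:R
         * \sum_(1 <= j < n.+1)
             ('C(m + j - 1, m) * 'C(n + j - 2, n - 1) * 'C(2 * n - 1 - j, n - 1))%:R
     /\ ((A_lam n (lam_md n m d))%:R : rat)
       = ASM n * \sum_(0 <= k < m.+1)
           ('C(m, k)%:R
            * (if (k < n)%N then
                 ((n + k - 1)`! * (2 * n - 1)`!)%:R
                 / (k`! * (n - k - 1)`! * (2 * n + k - 1)`!)%:R
               else 0)))
  /\ exists P Q : {poly rat},
       size P = (2 * m - (m.+1)./2).+1
       /\ size Q = (m - (m.+1)./2).+1
       /\ forall n d : nat, (1 <= n)%N ->
            Q.[n%:R] != 0
            /\ ((A_lam n (lam_md n m d))%:R : rat) = ASM n * (P.[n%:R] / Q.[n%:R]).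
Proof.
(* Turns the degrees [m + m./2] and [m./2] into the stated ones. *)
have mE : m = (uphalf m + m./2)%N by rewrite uphalf_half -addnA addnn odd_double_half.
split=> [[|n] d // _|].
  split; last exact: A_lam_md_ratio_sum.
  rewrite A_lam_md_sum big_add1 big_mkord; congr (_ / 'C(_, _)%:R * _); try lia.
  by apply: eq_bigr => -[k kn] _ /=; congr ('C(_, _) * 'C(_, _) * 'C(_, _))%:R; lia.
exists (numer m), (denom m); rewrite size_numer size_denom.
split; first by lia.
split=> [|[|n] d // _]; first by lia.
split; first exact: denom_neq0.
rewrite A_lam_md_ratio_sum; congr (_ * _).
rewrite /numer horner_sum mulr_suml big_mkord; apply: eq_bigr => k _.
rewrite (@ratio_term_horner m) ?leq_ord // hornerZ !mulrA.
by congr (_ * _ / _); rewrite horner_prod; apply: eq_bigr => c _; rewrite hornerXsubC.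
Qed.
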